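(* Fix $a$ and let $\delta$ be a root of $4az^2+(12a-2)z+9a+6$. Then the commutator-free Runge-Kutta scheme $$g_1=e,\quad g_2=\exp\big(-\tfrac h3 f_1\big),\quad g_3=\exp\Big(h\Big(\big(-\tfrac{2a\delta}{3}-2a\big) f_1+a f_2\Big)\Big),\quad f_r=f(\Lambda(g_r,p))\ (r=1,2,3),$$ $$y_{n+1}=\Lambda\Big(\exp\big(-\tfrac h3 f_1\big)\exp\Big(h\Big(\tfrac{-6a\delta+8a+3}{6a}f_1+\delta f_2-\tfrac{1}{2a} f_3\Big)\Big),p\Big)$$ has order 3 and reuses the exponential of the second stage as the second exponential of the update. As $a$ varies this is a one-parameter family of schemes for embedded pairs of order 3(2) with the ''first same as last'' property, the order 2 approximation $\hat y_{n+1}$ being formed from $f_1,f_2,f_3$ and $f(y_{n+1})$ (its coefficients are not specified). The discriminant of the equation for $\delta$ is $4(1-36a)$, which allows for easy generation of rational versions of the scheme; for instance $a=0$ works.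
   Context: Setting. Let $G$ be a Lie group with Lie algebra $\mathfrak g$ and identity $e$, $M$ a manifold, $\Lambda:G\times M\to M$ a group action with infinitesimal action $\lambda_*(u)(q)=\frac{d}{dt}\big|_{t=0}\Lambda(\exp(tu),q)$, $u\in\mathfrak g$, and $f:M\to\mathfrak g$. The scheme approximates the solution of $y'=\big(\lambda_*f(y)\big)(y)$ with step size $h$ starting from the point $p=y_n\in M$. Order. Let $\hat\varphi_h:M\to M$ be the map corresponding to one step of a method ($y_{n+1}$ or $\hat y_{n+1}$ as a function of $p$) and $\varphi_h$ the map which flows for time $h$ along the exact solution. The method has order $q$ if $\psi(\varphi_h(p))-\psi(\hat\varphi_h(p))=\mathcal O(h^{q+1})$ for all $C^\infty$ functions $\psi$ on $M$. An embedded pair of order 3(2) consists of $y_{n+1}$ of order 3 and $\hat y_{n+1}$ of order 2 sharing the same stages; ''first same as last'' means that $\hat y_{n+1}$ may use $f(y_{n+1})$, which is the first function evaluation of the next step.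
   Formalization: The scheme is taken for a ≠ 0, since its coefficients divide by 6a and 2a and are undefined at a = 0; ''a = 0 works'' is stated only as: at a = 0 the equation for δ has the rational root 3. *)

(* Defs.v *)
From HB Require Import structures.
From mathcomp Require Import all_boot all_order all_algebra.
From mathcomp Require Import all_classical all_reals all_analysis.
Import Order.TTheory GRing.Theory Num.Theory numFieldNormedType.Exports.
Set Implicit Arguments.
Unset Strict Implicit.
Unset Printing Implicit Defensive.
Local Open Scope classical_set_scope.
Local Open Scope ring_scope.

(* Smoothness on a set [U], meant for [U] open and [E] finite-dimensional: there,
   continuity of ['d f x v] in [x] for each fixed [v] is continuity of
   [x |-> 'd f x], so [Ck k] is the class C^k in Frechet's sense. *)
Fixpoint Ck (R : realType) (E F : normedModType R) (k : nat) (U : set E)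
    (f : E -> F) : Prop :=
  if k is k'.+1 then
    (forall x, U x -> differentiable f x) /\
    (forall v : E, Ck k' U (fun x => 'd f x v))
  else forall x, U x -> {for x, continuous f}.

Definition smooth_on (R : realType) (E F : normedModType R) (U : set E)
    (f : E -> F) : Prop := forall k, Ck k U f.

(* [coord] and [param] are inverse to each other between [dom] and
   [coord @` dom]; their values elsewhere are junk. *)
Record chart (R : realType) (T : topologicalType) (E : normedModType R) := Chart {
  dom : set T;
  coord :> T -> E;
  param : E -> T }.

Record is_chart (R : realType) (T : topologicalType) (E : normedModType R)
    (c : chart T E) : Prop := IsChart {
  chart_open_dom : open (dom c);
  chart_open_img : open (c @` dom c);
  chart_coordK : forall x, dom c x -> param c (c x) = x;
  chart_coord_cont : forall x, dom c x -> {for x, continuous c};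
  chart_param_cont : forall v, (c @` dom c) v -> {for v, continuous (param c)} }.

Definition atlas (R : realType) (T : topologicalType) (E : normedModType R) :=
  set (chart T E).

Record is_manifold (R : realType) (T : topologicalType) (E : normedModType R)
    (A : atlas T E) : Prop := IsManifold {
  manifold_hausdorff : hausdorff_space T;
  manifold_second_countable : @second_countable T;
  manifold_cover : forall x, exists2 c, A c & dom c x;
  manifold_chart : forall c, A c -> is_chart c;
  manifold_compat : forall c d, A c -> A d ->
    smooth_on (c @` (dom c `&` dom d)) (d \o param c) }.

Definition vec_atlas (R : realType) (E : normedModType R) : atlas E E :=
  [set Chart setT id id].

Definition prod_chart (R : realType) (S T : topologicalType)
    (E F : normedModType R) (c : chart S E) (d : chart T F) :
    chart (S * T)%type (E * F)%type :=
  Chart (dom c `*` dom d) (fun x => (c x.1, d x.2))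
    (fun v => (param c v.1, param d v.2)).

Definition prod_atlas (R : realType) (S T : topologicalType)
    (E F : normedModType R) (A : atlas S E) (B : atlas T F) :
    atlas (S * T)%type (E * F)%type :=
  [set prod_chart cd.1 cd.2 | cd in A `*` B].

Definition smooth_map (R : realType) (S T : topologicalType)
    (E F : normedModType R) (A : atlas S E) (B : atlas T F) (f : S -> T) : Prop :=
  continuous f /\
  forall c d, A c -> B d ->
    smooth_on (c @` (dom c `&` f @^-1` dom d)) (d \o f \o param c).

#[short(type="preTopologicalGroupType")]
HB.structure Definition PreTopologicalGroup := {G of Group G & Topological G}.

Record is_lie_group (R : realType) (G : preTopologicalGroupType)
    (E : normedModType R) (A : atlas G E) : Prop := IsLieGroup {
  lie_group_manifold : is_manifold A;
  lie_group_mul : smooth_map (prod_atlas A A) A (fun x : G * G => (x.1 * x.2)%g);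
  lie_group_inv : smooth_map A A (fun x : G => x^-1%g) }.

(* The Lie algebra, as a vector space, is T_e G, identified with R^n through a
   chart [c] at the identity: [u] stands for the velocity of the curves through
   [e] whose coordinates in [c] have derivative [u]. The exponential is the
   function such that each [t |-> exp (t u)] is the one-parameter subgroup with
   velocity [u]; these conditions determine it. *)
Definition is_lie_exp (R : realType) (G : preTopologicalGroupType) (n : nat)
    (A : atlas G 'rV[R]_n) (c : chart G 'rV[R]_n) (exp : 'rV[R]_n -> G) : Prop :=
  forall u : 'rV[R]_n,
    [/\ smooth_map (@vec_atlas R R^o) A (fun t : R^o => exp (t *: u)),
        forall s t : R, exp ((s + t) *: u) = (exp (s *: u) * exp (t *: u))%g
      & is_derive (0 : R) 1 (fun t : R => c (exp (t *: u))) u].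

Record is_smooth_action (R : realType) (G : preTopologicalGroupType)
    (M : topologicalType) (E F : normedModType R) (A : atlas G E) (B : atlas M F)
    (Lam : G -> M -> M) : Prop := IsSmoothAction {
  action_one : forall q, Lam 1%g q = q;
  action_mul : forall g h q, Lam (g * h)%g q = Lam g (Lam h q);
  action_smooth :
    smooth_map (prod_atlas A B) B (fun x : G * M => Lam x.1 x.2) }.

(* The data of a differential equation y' = (lambda_* f(y))(y). *)
Record lie_problem (R : realType) := LieProblem {
  dimG : nat;
  dimM : nat;
  G : preTopologicalGroupType;
  M : topologicalType;
  atlasG : atlas G 'rV[R]_dimG;
  atlasM : atlas M 'rV[R]_dimM;
  chart1 : chart G 'rV[R]_dimG;
  Exp : 'rV[R]_dimG -> G;
  Lam : G -> M -> M;
  f : M -> 'rV[R]_dimG;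
  problem_lie_group : is_lie_group atlasG;
  problem_manifold : is_manifold atlasM;
  problem_chart1 : atlasG chart1 /\ dom chart1 1%g;
  problem_exp : is_lie_exp atlasG chart1 Exp;
  problem_action : is_smooth_action atlasG atlasM Lam;
  problem_f : smooth_map atlasM (@vec_atlas R 'rV[R]_dimG) f }.

(* Coordinates in the chart [c] of the tangent vector lambda_*(u)(q). *)
Definition inf_action (R : realType) (P : lie_problem R)
    (c : chart (M P) 'rV[R]_(dimM P)) (u : 'rV[R]_(dimG P)) (q : M P) :
    'rV[R]_(dimM P) :=
  derive1 (fun t : R => c (Lam (Exp (t *: u)) q)) 0.

(* Solutions need not be global, so [phi t p] is only constrained for [t] in a
   neighbourhood of 0 that depends on [p]. *)
Definition is_exact_flow (R : realType) (P : lie_problem R)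
    (phi : R -> M P -> M P) : Prop :=
  forall p, phi 0 p = p /\
    \forall t \near (0 : R),
      {for t, continuous (fun s => phi s p)} /\
      forall c, atlasM c -> dom c (phi t p) ->
        is_derive t 1 (fun s : R => c (phi s p))
          (inf_action c (f (phi t p)) (phi t p)).

Definition method (R : realType) := forall P : lie_problem R, R -> M P -> M P.

Definition has_order (R : realType) (q : nat) (step : method R) : Prop :=
  forall (P : lie_problem R) (phi : R -> M P -> M P), is_exact_flow phi ->
  forall (p : M P) (psi : M P -> R^o),
    smooth_map (@atlasM R P) (@vec_atlas R R^o) psi ->
    (fun h : R => psi (phi h p) - psi (step P h p))
      =O_ (0 : R) (fun h : R => h ^+ q.+1 : R^o).

Definition f1 (R : realType) (P : lie_problem R) (p : M P) : 'rV[R]_(dimG P) :=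
  f (Lam 1%g p).

Definition g2 (R : realType) (P : lie_problem R) (h : R) (p : M P) : G P :=
  Exp (- (h / 3) *: f1 p).

Definition f2 (R : realType) (P : lie_problem R) (h : R) (p : M P) :
    'rV[R]_(dimG P) :=
  f (Lam (g2 h p) p).

Definition g3 (R : realType) (a delta : R) (P : lie_problem R) (h : R)
    (p : M P) : G P :=
  Exp (h *: ((- (2 * a * delta / 3) - 2 * a) *: f1 p + a *: f2 h p)).

Definition f3 (R : realType) (a delta : R) (P : lie_problem R) (h : R)
    (p : M P) : 'rV[R]_(dimG P) :=
  f (Lam (g3 a delta h p) p).

(* Meaningful only for [a != 0]: with [x / 0 = 0] the weights of the update at
   [a = 0] would not sum to 1. *)
Definition update_exp (R : realType) (a delta : R) (P : lie_problem R) (h : R)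
    (p : M P) : G P :=
  Exp (h *: (((- 6 * a * delta + 8 * a + 3) / (6 * a)) *: f1 p
               + delta *: f2 h p - (1 / (2 * a)) *: f3 a delta h p)).

Definition y_next (R : realType) (a delta : R) : method R := fun P h p =>
  Lam (Exp (- (h / 3) *: f1 p) * update_exp a delta h p)%g p.

(* f_1, f_2, f_3 and f(y_{n+1}). *)
Definition f_values (R : realType) (a delta : R) (P : lie_problem R) (h : R)
    (p : M P) : seq 'rV[R]_(dimG P) :=
  [:: f1 p; f2 h p; f3 a delta h p; f (y_next a delta h p)].

(* A general commutator-free update from these values: a product of
   exponentials, the [j]-th one with coefficients the row [beta j]. *)
Definition y_hat (R : realType) (a delta : R) (beta : seq 'rV[R]_4) :
    method R := fun P h p =>
  Lam (\big[*%g/1%g]_(b <- beta)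
         Exp (h *: \sum_(r < 4) b 0 r *: (f_values a delta h p)`_r)) p.

Definition delta_poly (K : fieldType) (a : K) : {poly K} :=
  (4 * a) *: 'X^2 + (12 * a - 2) *: 'X + (9 * a + 6)%:P.

Definition quadratic_discriminant (K : fieldType) (p : {poly K}) : K :=
  p`_1 ^+ 2 - 4 * p`_2 * p`_0.

(* Main.v *)
Require Import Defs.
From mathcomp Require Import all_boot all_order all_algebra.
From mathcomp Require Import all_classical all_reals all_analysis.
From mathcomp Require Import ring.
Import Order.TTheory GRing.Theory Num.Theory numFieldNormedType.Exports.
Set Implicit Arguments.
Unset Strict Implicit.
Unset Printing Implicit Defensive.
Local Open Scope classical_set_scope.
Local Open Scope ring_scope.

(* No structure constants, commutators or Baker-Campbell-Hausdorff series are needed.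
   In a chart at p, let D_i be the derivative along the fundamental vector field of
   the i-th basis vector of the Lie algebra. Along an orbit s |-> exp(s v) q one has
   d/ds psi = sum_i v_i D_i psi, so Taylor's formula expands psi(exp(v) q) in words
   in the D_i applied to psi, with a remainder C |v|^N uniform in v and q. Nesting
   these expansions gives those of f_2, f_3, of the update and of psi(y_{n+1}); the
   exact flow is expanded by integrating psi' = sum_i f_i D_i psi repeatedly. Since
   D_i D_j and D_j D_i are kept apart, the comparison of the coefficients up to h^3
   also covers the order condition on the commutator. *)

(** * Maps of class C^k *)

(** [Exp] is constrained only on the lines [t |-> t *: u]; its continuity in [u] is not given.
    Everything about [Exp v] is therefore read off the curve [s |-> Exp (s *: v)], which solves a
    differential equation whose right-hand side is linear in [v]. Constants are uniform in [v]
    because a word is a finite combination of fixed continuous functions, homogeneous in its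
    letters. The same equation must also show that the curve stays in the chart for small [v], since
    coordinates outside the domain are junk. The update is a product of two exponentials. A vector
    enters an exponential multiplied by [h], so each evaluation of [f] gains one order, and the
    update vector is needed only up to [h ^ 3]. *)

Lemma near_eq_diff (R : realType) (V W : normedModType R) (f g : V -> W) (x : V) :
  (\near x, f x = g x) -> differentiable f x ->
  differentiable g x /\ 'd g x = 'd f x :> (V -> W).
Proof.
move=> fg df; have fgx := nbhs_singleton fg.
have gE : g \o shift x = cst (g x) + 'd f x +o_ 0 id.
  apply/eqaddoP => e e0.
  have /eqaddoP/(_ e e0) := diff_locally df.
  have : \forall h \near (0 : V), f (h + x) = g (h + x).
    have [r r0 xr] := (nbhs_ballP _ _).1 fg.
    apply/nbhs_ballP; exists r => // h; rewrite -ball_normE /= sub0r normrN => hr.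
    by apply: xr; rewrite -ball_normE /= opprD addrCA subrr addr0 normrN.
  by apply: filterS2 => h /= /esym hE; rewrite !fctE /= hE fgx.
have dg : 'd g x = 'd f x :> (V -> W) by apply: diff_unique => //; exact: diff_continuous.
split=> //; apply/diff_locallyP; split; last by rewrite dg.
by move: (diff_continuous df); rewrite dg.
Qed.

Lemma open_near_eq (T S : topologicalType) (U : set T) (f g : T -> S) (x : T) :
  open U -> (forall y, U y -> f y = g y) -> U x -> \near x, f x = g x.
Proof.
by move=> oU fg Ux; near=> y; apply: fg; near: y; exact: open_nbhs_nbhs.
Unshelve. all: by end_near. Qed.

(** A differential depends only on values near the point, and openness of [U] turns agreement on [U]
    into agreement near each of its points. This lets derivative formulas that hold only on [U] be
    substituted. *)
Lemma eq_Ck (R : realType) (E F : normedModType R) k (U : set E) (f g : E -> F) :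
  open U -> (forall x, U x -> f x = g x) -> Ck k U f -> Ck k U g.
Proof.
move=> oU; elim: k f g => [|k IH] f g fg /=.
  move=> cf x Ux; have fgx := open_near_eq oU fg Ux.
  rewrite /prop_for /continuous_at -fg//; apply: cvg_trans (cf _ Ux).
  exact: near_eq_cvg.
move=> [df cdf]; have H x (Ux : U x) := near_eq_diff (open_near_eq oU fg Ux) (df _ Ux).
split=> [x /H[]//|v]; apply: IH (cdf v) => x Ux.
by have [_ ->] := H _ Ux.
Qed.

Lemma Ck_continuous (R : realType) (E F : normedModType R) k (U : set E) (f : E -> F) x :
  Ck k U f -> U x -> {for x, continuous f}.
Proof.
case: k => [|k] /=; first by move=> + Ux; apply.
by case=> df _ Ux; apply: differentiable_continuous; exact: df.
Qed.

Lemma CkS (R : realType) (E F : normedModType R) k (U : set E) (f : E -> F) :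
  Ck k.+1 U f -> Ck k U f.
Proof.
elim: k f => [|k IH] f [df cdf]; first by move=> x /df /differentiable_continuous.
by split=> // v; exact/IH/cdf.
Qed.

Lemma Ck_cst (R : realType) (E F : normedModType R) k (U : set E) (a : F) :
  Ck k U (fun _ : E => a).
Proof.
elim: k a => [|k IH] a /=; first by move=> x _; exact: cvg_cst.
split=> [x _|v]; first exact: differentiable_cst.
by rewrite (_ : (fun _ => _) = fun=> 0) //; apply: funext => x; rewrite (diff_cst a).
Qed.

Lemma CkD (R : realType) (E F : normedModType R) k (U : set E) (f g : E -> F) :
  open U -> Ck k U f -> Ck k U g -> Ck k U (f \+ g).
Proof.
move=> oU; elim: k f g => [|k IH] f g /=.
  by move=> cf cg x Ux; apply: cvgD; [exact: cf|exact: cg].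
move=> [df cdf] [dg cdg]; split=> [x Ux|v].
  by apply: differentiableD; [exact: df|exact: dg].
apply: eq_Ck (IH _ _ (cdf v) (cdg v)) => // x Ux.
by rewrite (diffD (df _ Ux) (dg _ Ux)).
Qed.

Lemma CkM (R : realType) (E : normedModType R) k (U : set E) (f g : E -> R^o) :
  open U -> Ck k U f -> Ck k U g -> Ck k U (f \* g : E -> R^o).
Proof.
move=> oU; elim: k f g => [|k IH] f g.
  by move=> cf cg x Ux; apply: cvgM; [exact: cf|exact: cg].
move=> cf cg; have [df cdf] := cf; have [dg cdg] := cg; split=> [x Ux|v].
  by apply: differentiableM; [exact: df|exact: dg].
have := CkD oU (IH _ _ (CkS cf) (cdg v)) (IH _ _ (CkS cg) (cdf v)).
apply: eq_Ck => // x Ux.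
by rewrite (diffM (df _ Ux) (dg _ Ux)).
Qed.

Lemma diff_coord (R : realType) (E : normedModType R) m (f : E -> 'rV[R]_m) x v j :
  differentiable f x ->
  differentiable (fun y => f y 0 j : R) x /\
  'd (fun y => f y 0 j : R) x v = 'd f x v 0 j.
Proof.
move=> df; have dfj : differentiable (fun y => f y 0 j : R) x.
  exact: (differentiable_comp df (differentiable_coord (f x) 0 j)).
split=> //; rewrite -!deriveE // derive_mx ?mxE //; exact: diff_derivable.
Qed.

Lemma Ck_coord (R : realType) (E : normedModType R) m k (U : set E)
  (f : E -> 'rV[R]_m) j :
  open U -> Ck k U f -> Ck k U (fun x => f x 0 j : R^o).
Proof.
move=> oU; elim: k f => [|k IH] f.
  move=> cf x Ux.
  exact: (continuous_comp (cf x Ux) (@coord_continuous _ _ _ 0 j (f x))).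
move=> [df cdf]; split=> [x Ux|v]; first by have [] := diff_coord 0 j (df x Ux).
apply: eq_Ck (IH _ (cdf v)) => // x Ux.
by have [_ ->] := diff_coord v j (df x Ux).
Qed.

Lemma diff_sub_pair (R : realType) (E F G : normedModType R) (f : (E * F)%type -> G)
  (e : E) (x v : F) : differentiable f (e, x) ->
  differentiable (fun y => f (e, y)) x /\
  'd (fun y => f (e, y)) x v = 'd f (e, x) (0, v).
Proof.
move=> df; have dp : is_diff x (fun y : F => (e, y)) (fun y => (0, y)).
  exact: (@is_diff_pair _ _ _ _ (cst e) 0 id id).
have [dpx dpE] := dp.
split; first exact: (@differentiable_comp _ _ _ _ (fun y => (e, y)) f).
by rewrite (@diff_comp _ _ _ _ (fun y => (e, y)) f) //= dpE.
Qed.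

(** Moving [x] alone differentiates in the direction [(0, v)]. Used with [e] the coordinates of the
    identity, to view a partial derivative of the action as a smooth vector field. *)
Lemma Ck_partial (R : realType) (E F G : normedModType R) k (W : set (E * F)%type)
    (f : (E * F)%type -> G) (e : E) (U : set F) :
  open U -> (forall x, U x -> W (e, x)) -> Ck k W f -> Ck k U (fun x => f (e, x)).
Proof.
move=> oU UW; elim: k f => [|k IH] f.
  move=> cf x /UW /cf cx; apply: (@continuous_comp _ _ _ (fun y => (e, y)) f) => //.
  by apply: cvg_pair => //=; exact: cvg_cst.
move=> [df cdf]; split=> [x Ux|v]; first by have [] := diff_sub_pair 0 (df _ (UW _ Ux)).
apply: eq_Ck (IH _ (cdf (0, v))) => // x Ux.
by have [_ ->] := diff_sub_pair v (df _ (UW _ Ux)).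
Qed.

Lemma Ck_sum (R : realType) (E F : normedModType R) k (U : set E) n (f : 'I_n -> E -> F) :
  open U -> (forall i, Ck k U (f i)) -> Ck k U (fun x => \sum_(i < n) f i x).
Proof.
move=> oU; elim: n f => [|n IH] f cf.
  by rewrite (_ : (fun _ => _) = fun=> 0) ?funeqE => [|?]; [exact: Ck_cst|rewrite big_ord0].
rewrite (_ : (fun _ => _) = (fun x => \sum_(i < n) f (widen_ord (leqnSn n) i) x) \+ f ord_max).
  by apply: CkD; [|exact: IH|].
by apply/funext => x; rewrite big_ord_recr.
Qed.

(** * Taylor's formula *)

Lemma mx_coord_norm (R : realType) m n (v : 'M[R]_(m, n)) i j : `|v i j| <= `|v|.
Proof. by rewrite [leRHS]/Num.norm /= mx_normrE; exact: (le_bigmax _ _ (i, j)). Qed.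

Lemma rV_norm_le (R : realType) n (v : 'rV[R]_n) (c : R) :
  0 <= c -> (forall j, `|v 0 j| <= c) -> `|v| <= c.
Proof.
move=> c0 vc; rewrite [leLHS]/Num.norm /= mx_normrE.
by apply: bigmax_le => // -[i j] _ /=; rewrite ord1.
Qed.

Lemma MVT_bound (R : realType) (f df : R -> R) (c t : R) :
  0 <= t ->
  (forall s, 0 <= s <= t -> is_derive s 1 f (df s)) ->
  (forall s, 0 <= s <= t -> `|df s| <= c) ->
  `|f t - f 0| <= c * t.
Proof.
move=> t0 fd dfc.
have [||s st ->] := @MVT_segment R f df 0 t t0.
- by move=> s; rewrite in_itv /= => /andP[/ltW s0 /ltW st]; apply: fd; rewrite s0.
- by apply: derivable_within_continuous => s; rewrite in_itv /= => /fd [].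
by rewrite subr0 normrM (ger0_norm t0) ler_wpM2r// dfc//; move: st; rewrite in_itv.
Qed.

(** The derivative of the remainder is the remainder, one order lower, of the shifted family, and
    the remainder vanishes at 0; the mean value inequality on [0, 1] then keeps the constant. The
    factor [1 / N!] is given up, since only the power of the vector matters later. *)
Lemma taylor_bound (R : realType) (N : nat) (g : nat -> R -> R) (c : R) :
  (forall k (s : R), (k < N)%N -> 0 <= s <= 1 -> is_derive s 1 (g k) (g k.+1 s)) ->
  (forall s, 0 <= s <= 1 -> `|g N s| <= c) ->
  forall t, 0 <= t <= 1 ->
  `|g 0 t - \sum_(k < N) g k 0 * (k`!%:R^-1 * t ^+ k)| <= c.
Proof.
elim: N g => [|N IH] g gd gc t t01; first by rewrite big_ord0 subr0 gc.
have c0 : 0 <= c by rewrite (le_trans (normr_ge0 _) (gc _ t01)).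
have {}IH := IH (fun k => g k.+1) (fun k s => gd k.+1 s) gc.
pose H s := g 0 s - \sum_(k < N.+1) g k 0 * (k`!%:R^-1 * s ^+ k).
have Hd (s : R) : 0 <= s <= 1 ->
    is_derive s 1 H (g 1 s - \sum_(k < N) g k.+1 0 * (k`!%:R^-1 * s ^+ k)).
  move=> s01; apply: is_deriveB; first exact: gd.
  have E : (fun x : R => \sum_(k < N.+1) g k 0 * (k`!%:R^-1 * x ^+ k)) =
     \sum_(k < N.+1) (fun x => g k 0 * (k`!%:R^-1 * x ^+ k)).
    by apply/funext => x; rewrite fct_sumE.
  rewrite E; apply: is_derive_eq.
    apply: (@is_derive_sum _ _ _ _ _ _ _
      (fun k : 'I_N.+1 => g k 0 * (k`!%:R^-1 * (k%:R * s ^+ k.-1)))) => k.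
    have Ek : (fun x : R => g k 0 * (k`!%:R^-1 * x ^+ k)) =
       (g k 0 * k`!%:R^-1) \*: (id ^+ k).
      by apply/funext => x /=; rewrite mulrA exprfctE.
    rewrite Ek; apply: is_derive_eq.
    by rewrite [_%:A]mulr1; exact: esym (mulrA _ _ _).
  rewrite big_ord_recl mul0r !mulr0 add0r; apply: eq_bigr => k _ /=.
  rewrite /bump /= add1n factS natrM; congr (_ * _).
  by rewrite invfM mulrACA mulVf ?pnatr_eq0 ?mul1r.
have H0 : H 0 = 0.
  rewrite /H big_ord_recl expr0 fact0 invr1 !mulr1 big1 ?addr0 ?subrr // => k _.
  by rewrite lift0 expr0n /= !mulr0.
rewrite -/(H t) -[H t]subr0 -[X in _ - X]H0.
case/andP: t01 => t0 t1.
apply: le_trans (MVT_bound t0 _ _) _.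
- by move=> s /andP[s0 st]; apply: Hd; rewrite s0 (le_trans st).
- by move=> s /andP[s0 st]; apply: IH; rewrite s0 (le_trans st).
by rewrite ler_piMr.
Qed.

(** * Words in Lie derivatives *)

Lemma diff_lincomb (R : realType) (V W : normedModType R) (psi : V -> W) (x : V)
  n (c : 'I_n -> R) (w : 'I_n -> V) :
  'd psi x (\sum_(i < n) c i *: w i) = \sum_(i < n) c i *: 'd psi x (w i).
Proof.
rewrite raddf_sum; apply: eq_bigr => i _; exact: linearZ.
Qed.

Lemma diff_coordE (R : realType) m (V : normedModType R) (psi : 'rV[R]_m -> V)
    (x w : 'rV[R]_m) :
  'd psi x w = \sum_(j < m) w 0 j *: 'd psi x (delta_mx 0 j).
Proof.
by rewrite -diff_lincomb -row_sum_delta.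
Qed.

Section LieDerivatives.
Context {R : realType} {n m : nat} (X : 'I_n -> 'rV[R]_m -> 'rV[R]_m).
Context (U : set 'rV[R]_m).
Implicit Types (psi : 'rV[R]_m -> R) (u v : 'rV[R]_n) (l : seq 'rV[R]_n).

Definition lie_deriv i psi : 'rV[R]_m -> R := fun x => 'd psi x (X i x).

(* The head of the list is the innermost derivative. *)
Fixpoint lie_word l psi (x : 'rV[R]_m) : R :=
  if l is v :: l' then \sum_(i < n) v 0 i * lie_word l' (lie_deriv i psi) x
  else psi x.

Hypothesis oU : open U.
Hypothesis smoothX : forall i, smooth_on U (X i).

Let smooth psi := @smooth_on R 'rV[R]_m R^o U psi.

Lemma smooth_differentiable psi x : smooth psi -> U x -> differentiable psi x.
Proof. by move=> /(_ 1)[+ _] => /(_ x). Qed.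

Lemma smooth_continuous psi x : smooth psi -> U x -> {for x, continuous psi}.
Proof. by move=> /(_ 0) + Ux; apply. Qed.

(** [Ck] controls ['d psi x w] for fixed [w] only, whereas the direction [X i x] moves with [x];
    splitting it into coordinates leaves sums of products of smooth functions. *)
Lemma smooth_lie_deriv i psi : smooth psi -> smooth (lie_deriv i psi).
Proof.
move=> spsi k.
have [_ dpsi] := spsi k.+1.
suff : Ck k U (fun x => \sum_(j < m)
    ((fun y => X i y 0 j : R^o) \* (fun y => 'd psi y (delta_mx 0 j) : R^o)) x : R^o).
  apply: eq_Ck => // x Ux.
  exact: esym (diff_coordE psi x (X i x)).
apply: Ck_sum => // j; apply: CkM => //.
  by apply: Ck_coord => //; exact: smoothX.
exact: dpsi.
Qed.

Lemma is_derive_lie_deriv psi (gam : R -> 'rV[R]_m) (t : R) v :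
  smooth psi -> U (gam t) ->
  is_derive t 1 gam (\sum_(i < n) v 0 i *: X i (gam t)) ->
  is_derive t 1 (psi \o gam) (\sum_(i < n) v 0 i * lie_deriv i psi (gam t)).
Proof.
move=> spsi Ut [dg gE].
have dpsi := smooth_differentiable spsi Ut.
have dgt : differentiable gam t by apply/derivable1_diffP.
apply: DeriveDef; first exact/derivable1_diffP/differentiable_comp.
rewrite deriveE; last exact: differentiable_comp.
by rewrite diff_comp //= -(deriveE _ dgt) gE diff_lincomb.
Qed.

(** The earlier letters are constant vectors, so differentiating along the curve adds one outermost
    derivative, at the end of the list. *)
Lemma is_derive_lie_word l psi (gam : R -> 'rV[R]_m) (t : R) v :
  smooth psi -> U (gam t) ->
  is_derive t 1 gam (\sum_(i < n) v 0 i *: X i (gam t)) ->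
  is_derive t 1 (lie_word l psi \o gam) (lie_word (rcons l v) psi (gam t)).
Proof.
move=> spsi Ut dg; elim: l psi spsi => [|w l IH] psi spsi.
  exact: is_derive_lie_deriv.
rewrite (_ : _ \o _ = \sum_(i < n) (w 0 i \*: (lie_word l (lie_deriv i psi) \o gam))).
  rewrite /=; apply: is_derive_sum => i; apply: is_deriveZ.
  exact/IH/smooth_lie_deriv.
by apply/funext => s; rewrite fct_sumE.
Qed.

(** Each component of [v] is at most [|v|], which yields one factor per letter; what is left are
    finitely many continuous functions, bounded near [x0]. The constant depends on the fixed prefix
    [l] but not on [v]. *)
Lemma lie_word_near_bound l N psi x0 : smooth psi -> U x0 ->
  exists2 C, 0 <= C & \forall x \near x0,
    forall v, `|lie_word (l ++ nseq N v) psi x| <= C * `|v| ^+ N.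
Proof.
move=> + Ux0; elim: l psi => [|w l IHl] psi spsi.
  elim: N psi spsi => [|N IHN] psi spsi.
    exists (`|psi x0| + 1); first by rewrite addr_ge0.
    have /cvgrPdist_lt/(_ 1 ltr01) := smooth_continuous spsi Ux0.
    apply: filterS => x xx0 v; rewrite /= expr0 mulr1.
    rewrite -[psi x](subrK (psi x0)) addrC (le_trans (ler_normD _ _))// lerD2l.
    by rewrite distrC ltW.
  have /choice[C HC] : forall i, exists C, 0 <= C /\ \forall x \near x0,
      forall v, `|lie_word (nseq N v) (lie_deriv i psi) x| <= C * `|v| ^+ N.
    by move=> i; have [C C0 HC] := IHN _ (smooth_lie_deriv i spsi); exists C.
  exists (\sum_(i < n) C i); first by apply: sumr_ge0 => i _; have [] := HC i.
  have := @filter_forall _ _ _ (nbhs x0) (nbhs_filter x0) (fun i => (HC i).2).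
  apply: filterS => x Hx v /=.
  rewrite mulr_suml (le_trans (ler_norm_sum _ _ _))// ler_sum// => i _.
  rewrite normrM exprS mulrCA ler_pM//; exact: mx_coord_norm.
have /choice[C HC] : forall i, exists C, 0 <= C /\ \forall x \near x0,
    forall v, `|lie_word (l ++ nseq N v) (lie_deriv i psi) x| <= C * `|v| ^+ N.
  by move=> i; have [C C0 HC] := IHl _ (smooth_lie_deriv i spsi); exists C.
exists (\sum_(i < n) `|w 0 i| * C i).
  by apply: sumr_ge0 => i _; rewrite mulr_ge0//; have [] := HC i.
have := @filter_forall _ _ _ (nbhs x0) (nbhs_filter x0) (fun i => (HC i).2).
apply: filterS => x Hx v /=.
rewrite mulr_suml (le_trans (ler_norm_sum _ _ _))// ler_sum// => i _.
by rewrite normrM -mulrA ler_wpM2l.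
Qed.

(** [C] and [r] are chosen before [v] and [gam]: one estimate serves all orbits inside the ball, so
    the vector may later depend on the step. *)
Lemma lie_word_taylor l N psi x0 : smooth psi -> U x0 ->
  exists2 C, 0 <= C & exists2 r, 0 < r &
  forall v (gam : R -> 'rV[R]_m),
    (forall s : R, 0 <= s <= 1 -> ball x0 r (gam s) /\
      is_derive s 1 gam (\sum_(i < n) v 0 i *: X i (gam s))) ->
    `|lie_word l psi (gam 1) -
      \sum_(k < N) lie_word (l ++ nseq k v) psi (gam 0) / k`!%:R|
      <= C * `|v| ^+ N.
Proof.
move=> spsi Ux0; have [C C0 HC] := lie_word_near_bound l N spsi Ux0.
have /nbhs_ballP[r r0 Hr] : \forall x \near x0, U x /\
    forall v, `|lie_word (l ++ nseq N v) psi x| <= C * `|v| ^+ N.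
  by apply: filterI => //; exact: open_nbhs_nbhs.
exists C => //; exists r => // v gam Hg.
have := @taylor_bound R N (fun k s => lie_word (l ++ nseq k v) psi (gam s)) (C * `|v| ^+ N)
  _ _ 1 _.
rewrite cats0 (eq_bigr (fun k : 'I_N => lie_word (l ++ nseq k v) psi (gam 0) / k`!%:R)).
  apply; last by rewrite ler01 lexx.
    move=> k s _ /Hg[/Hr[Us _] dg].
    rewrite (_ : nseq k.+1 v = rcons (nseq k v) v) ?rcons_cat.
      by rewrite -rcons_cat; exact: is_derive_lie_word.
    by elim: k => //= k <-.
  by move=> s /Hg[/Hr[_ +] _]; apply.
by move=> k _; rewrite expr1n mulr1.
Qed.
End LieDerivatives.

(** * Orbits of one-parameter subgroups *)

Lemma is_derive_shift0 (R : realType) (V : normedModType R) (g : R -> V) (s : R) (d : V) :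
  is_derive (0 : R) 1 (fun t => g (t + s)) d -> is_derive s 1 g d.
Proof.
have E : (fun h : R => h^-1 *: (((fun t => g (t + s)) \o shift 0) (h *: 1) - g (0 + s))) =
         (fun h : R => h^-1 *: ((g \o shift s) (h *: 1) - g s)).
  by apply/funext => h /=; rewrite addr0 add0r.
by case; rewrite /derivable /derive /= E => *; apply: DeriveDef.
Qed.

Section Coordinates.
Context {R : realType} (P : lie_problem R) (c : chart (M P) 'rV[R]_(dimM P)).
Hypothesis Ac : atlasM c.

Let U : set 'rV[R]_(dimM P) := c @` dom c.
Let e0 := chart1 P 1%g.

Definition action_coord (z : ('rV[R]_(dimG P) * 'rV[R]_(dimM P))%type) :=
  c (Lam (param (chart1 P) z.1) (param c z.2)).

(** The fundamental vector field of the [i]-th basis vector, taken as a partial derivative of the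
    action rather than along [Exp], so that its smoothness is inherited from the action. *)
Definition action_field (i : 'I_(dimG P)) (x : 'rV[R]_(dimM P)) : 'rV[R]_(dimM P) :=
  'd action_coord (e0, x) (delta_mx 0 i, 0).

Lemma chart_isP : is_chart c.
Proof. exact: manifold_chart (problem_manifold P) c Ac. Qed.

Lemma chart1_isP : is_chart (chart1 P).
Proof.
apply: manifold_chart (lie_group_manifold (problem_lie_group P)) _ _.
by have [] := problem_chart1 P.
Qed.

Lemma open_chart_image : open U.
Proof. exact: chart_open_img chart_isP. Qed.

Let W : set ('rV[R]_(dimG P) * 'rV[R]_(dimM P))%type :=
  prod_chart (chart1 P) c @`
    (dom (prod_chart (chart1 P) c) `&` (fun x : G P * M P => Lam x.1 x.2) @^-1` dom c).

Lemma smooth_action_coord : smooth_on W action_coord.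
Proof.
have [_ sm] := action_smooth (problem_action P).
have [A1 _] := problem_chart1 P.
by apply: (sm (prod_chart (chart1 P) c) c) => //; exists (chart1 P, c).
Qed.

Lemma chart_image_action_domain x : U x -> W (e0, x).
Proof.
have [_ d1] := problem_chart1 P.
case=> q dq <-; exists (1%g, q) => //; split => //=.
by rewrite (action_one (problem_action P)).
Qed.

Lemma smooth_action_field i : smooth_on U (action_field i).
Proof.
move=> k; have [_ dL] := smooth_action_coord k.+1.
exact: (Ck_partial open_chart_image chart_image_action_domain (dL _)).
Qed.

Lemma diff_action_coord x u :
  'd action_coord (e0, x) (u, 0) = \sum_(i < dimG P) u 0 i *: action_field i x.
Proof.
rewrite -diff_lincomb; congr ('d _ _ _); rewrite {1}[u]row_sum_delta; apply/esym.
apply: (big_ind2 (fun z w => z = (w, 0))) => [//|z1 w1 z2 w2 -> ->|i _].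
  by congr pair; rewrite addr0.
by congr pair; rewrite scaler0.
Qed.

Lemma Exp0 : Exp (0 : 'rV[R]_(dimG P)) = 1%g.
Proof.
have [_ /(_ 0 0) + _] := @problem_exp R P 0.
rewrite addr0 scale0r => h.
by apply: (@mulgI _ (Exp 0)); rewrite mulg1.
Qed.

Lemma continuous_Exp_line (v : 'rV[R]_(dimG P)) : continuous (fun t : R => Exp (t *: v)).
Proof. by have [[]] := @problem_exp R P v. Qed.

Lemma continuous_orbit (v : 'rV[R]_(dimG P)) (q : M P) :
  continuous (fun t : R => Lam (Exp (t *: v)) q).
Proof.
have [cL _] := action_smooth (problem_action P).
move=> t; apply: (@continuous_comp _ _ _ (fun t : R => (Exp (t *: v), q))
  (fun x : G P * M P => Lam x.1 x.2)); last exact: cL.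
by apply: cvg_pair; [exact: continuous_Exp_line|exact: cvg_cst].
Qed.

(** The one-parameter law restarts the orbit at its current point: [Exp ((t + s) *: v)] acts as
    [Exp (t *: v)] after [Exp (s *: v)]. It remains to differentiate at [t = 0], by the chain rule
    through [action_coord]. *)
Lemma is_derive_orbit v q (s : R) : dom c (Lam (Exp (s *: v)) q) ->
  is_derive s 1 (fun t : R => c (Lam (Exp (t *: v)) q))
    (\sum_(i < dimG P) v 0 i *: action_field i (c (Lam (Exp (s *: v)) q))).
Proof.
move=> ds; apply: is_derive_shift0.
set y := c _.
have Uy : U y by exists (Lam (Exp (s *: v)) q).
have dL : differentiable action_coord (e0, y).
  by have [+ _] := smooth_action_coord 1; apply; exact: chart_image_action_domain.
have [_ d1] := problem_chart1 P.
have [_ expD [da daE]] := @problem_exp R P v.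
have a0 : chart1 P (Exp ((0 : R) *: v)) = e0 by rewrite scale0r Exp0.
apply: (@near_eq_is_derive _ _ _
    (action_coord \o (fun t : R => (chart1 P (Exp (t *: v)), y)))).
  (* Passing through [action_coord] requires [Exp (t *: v)] to lie in the chart at the identity,
     which is ensured for small [t] only. *)
  have : \forall t \near (0 : R), dom (chart1 P) (Exp (t *: v)).
    apply: (continuous_Exp_line (v := v)) => /=.
    rewrite scale0r Exp0; apply: open_nbhs_nbhs; split => //.
    exact: chart_open_dom chart1_isP.
  apply: filterS => t dt; rewrite /action_coord /=.
  rewrite (chart_coordK chart1_isP dt) (chart_coordK chart_isP ds).
  by rewrite -(action_mul (problem_action P)) -expD.
have da1 : differentiable (fun t : R => chart1 P (Exp (t *: v))) 0.
  exact/derivable1_diffP.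
have dp : differentiable (fun t : R => (chart1 P (Exp (t *: v)), y)) 0.
  by apply: differentiable_pair => //; exact: differentiable_cst.
have dL0 : differentiable action_coord ((fun t : R => (chart1 P (Exp (t *: v)), y)) 0).
  by rewrite /= a0.
have dcmp := differentiable_comp dp dL0.
apply: DeriveDef; first exact/derivable1_diffP.
rewrite (deriveE _ dcmp) (diff_comp dp dL0) /= (diff_pair da1 (differentiable_cst y 0)) /=.
rewrite -(deriveE _ da1) daE a0 -diff_action_coord //; congr ('d _ _ (_, _)).
by rewrite (diff_cst y).
Qed.

Lemma inf_actionE u q : dom c q ->
  inf_action c u q = \sum_(i < dimG P) u 0 i *: action_field i (c q).
Proof.
move=> dq; rewrite /inf_action derive1E.
have E : Lam (Exp ((0 : R) *: u)) q = q.
  by rewrite scale0r Exp0 (action_one (problem_action P)).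
have [_ ->] := @is_derive_orbit u q 0 (eq_ind_r (dom c) dq E).
by rewrite E.
Qed.

End Coordinates.

(** * Short orbits do not leave a chart *)

Section NoEscape.
Context {R : realType} (P : lie_problem R) (c : chart (M P) 'rV[R]_(dimM P)).
Hypothesis Ac : atlasM c.
Let U : set 'rV[R]_(dimM P) := c @` dom c.

(** By Heine-Borel the closed ball is compact, and [param c] is continuous on it; the compact image
    is closed because [M] is Hausdorff. *)
Lemma closed_param_ball x0 r : 0 < r -> (forall x, `|x0 - x| <= r -> U x) ->
  closed (param c @` [set x : 'rV[R]_(dimM P) | `|x0 - x| <= r]).
Proof.
move=> r0 rU; apply: compact_closed.
  exact: manifold_hausdorff (problem_manifold P).
apply: continuous_compact.
  apply: continuous_in_subspaceT => x; rewrite inE => /= /rU Ux.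
  exact: chart_param_cont (chart_isP Ac) _ Ux.
apply: bounded_closed_compact; last exact: closed_closed_ball_.
exists (`|x0| + r); split; first exact: num_real.
move=> b rb x /= xr; rewrite (le_trans _ (ltW rb))//.
by rewrite -[x](subrK x0) addrC (le_trans (ler_normD _ _))// lerD2l distrC.
Qed.

(** At the infimum of the failure times the second hypothesis gives [Q], and openness pushes [Q]
    beyond it. For [t = 0] the premise on earlier times is empty, so that hypothesis also covers the
    starting point. *)
Lemma first_exit (Q : R -> Prop) :
  (forall s : R, Q s -> \forall t \near s, Q t) ->
  (forall t, 0 <= t <= 1 -> (forall s, 0 <= s < t -> Q s) -> Q t) ->
  forall t, 0 <= t <= 1 -> Q t.
Proof.
move=> Qo Qc t t01; apply: contrapT => nQ.
pose Z := [set s : R | 0 <= s <= 1 /\ ~ Q s].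
have Zt : Z t by [].
have Zl : lbound Z 0 by move=> s [/andP[]].
have Zi : has_inf Z by split; [exists t|exists 0].
have i0 : 0 <= inf Z by apply: lb_le_inf => //; exists t.
have i1 : inf Z <= 1.
  by case/andP: t01 => _; apply: le_trans; apply: ge_inf Zt; exists 0.
have Qi : Q (inf Z).
  apply: Qc; first by rewrite i0.
  move=> s /andP[s0 si]; apply: contrapT => nQs.
  have /(ge_inf (ex_intro _ 0 Zl)) : Z s by split => //; rewrite s0 (le_trans (ltW si)).
  by rewrite leNgt si.
have /nbhs_ballP[e e0 He] := Qo _ Qi.
have [z Zz ze] := inf_adherent e0 Zi.
case: (Zz) => _; apply; apply: He.
have iz := ge_inf (ex_intro _ 0 Zl) Zz.
by rewrite /ball /= distrC ger0_norm ?subr_ge0// ltrBlDl.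
Qed.

(* A first exit time argument: [Exp] is not yet known to be continuous, but on a
   ball the orbit moves at speed at most a constant times [|v|], and the ball
   has a closed image in the Hausdorff space [M]. *)
Lemma orbit_stays x0 r : U x0 -> 0 < r -> exists2 e, 0 < e &
  forall v x, `|v| < e -> `|x0 - x| < e -> forall s : R, 0 <= s <= 1 ->
    let q := Lam (Exp (s *: v)) (param c x) in dom c q /\ `|x0 - c q| < r.
Proof.
move=> Ux0 r0.
have cX i : {for x0, continuous (action_field c i)}.
  exact: Ck_continuous (smooth_action_field Ac i 0) Ux0.
have /(@filter_forall _ _ _ (nbhs x0) (nbhs_filter x0)) cXb : forall i,
    \forall x \near x0, `|action_field c i x| <= `|action_field c i x0| + 1.
  move=> i; have /cvgrPdist_lt/(_ 1 ltr01) := cX i.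
  apply: filterS => x xx0; rewrite -[action_field c i x](subrK (action_field c i x0)).
  by rewrite addrC (le_trans (ler_normD _ _))// lerD2l distrC ltW.
have /nbhs_ballP[r1 /= r10 Hr1] : \forall x \near x0, U x /\
    forall i, `|action_field c i x| <= `|action_field c i x0| + 1.
  apply: filterI => //; apply: open_nbhs_nbhs; split => //; exact: open_chart_image.
(* Halving keeps the closed ball of radius [rho] inside [U], where the fields are bounded. *)
pose rho := Num.min r r1 / 2.
have m0 : 0 < Num.min r r1 by rewrite lt_min r0.
have rho0 : 0 < rho by rewrite divr_gt0.
have half_lt (a b : R) : 0 < a -> a <= b -> a / 2 < b.
  by move=> a0; apply: lt_le_trans; rewrite ltr_pdivrMr// ltr_pMr// ltr1n.
have rhor : rho < r by apply: half_lt; rewrite ?ge_min ?lexx.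
have rhor1 : rho < r1 by apply: half_lt; rewrite ?ge_min ?lexx ?orbT.
have ballU x : `|x0 - x| <= rho -> U x /\
    forall i, `|action_field c i x| <= `|action_field c i x0| + 1.
  by move=> xr; apply: Hr1; rewrite -ball_normE /=; exact: le_lt_trans rhor1.
pose C := \sum_i (`|action_field c i x0| + 1).
have C0 : 0 <= C by apply: sumr_ge0 => i _; rewrite addr_ge0.
(* With this [e], a displacement of at most [e * C] during time 1 plus an initial offset below [e]
   remains strictly below [rho]. *)
exists (rho / (C + 2)); first by rewrite divr_gt0// ltr_wpDl.
set e := rho / _.
have eC : e * C + e < rho.
  rewrite -{2}[e]mulr1 -mulrDr /e mulrAC ltr_pdivrMr ?ltr_wpDl// ltr_pM2l//.
  by rewrite ltrD2l ltr1n.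
have e0 : 0 < e by rewrite divr_gt0// ltr_wpDl.
have erho : e <= rho by rewrite (le_trans _ (ltW eC))// lerDr mulr_ge0// ltW.
move=> v x ve xe.
pose m (s : R) := Lam (Exp (s *: v)) (param c x).
have Ux : U x by have [] := ballU x; rewrite ?(le_trans (ltW xe)).
have m0E : m 0 = param c x by rewrite /m scale0r Exp0 (action_one (problem_action P)).
have cmx : dom c (param c x) /\ c (param c x) = x.
  by case: Ux => q dq <-; rewrite (chart_coordK (chart_isP Ac) dq).
have cm : continuous m by exact: continuous_orbit.
suff main (s : R) : 0 <= s <= 1 -> dom c (m s) /\ `|x0 - c (m s)| < rho.
  by move=> s /main[ds sr]; split => //; exact: lt_trans rhor.
move: s; apply: first_exit => [s [ds sr]|t /andP[t0 t1] Ht].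
  have cc : {for s, continuous (c \o m)}.
    apply: continuous_comp; first exact: cm.
    exact: chart_coord_cont (chart_isP Ac) _ ds.
  apply: filterI.
    apply: cm; apply: open_nbhs_nbhs; split => //.
    exact: chart_open_dom (chart_isP Ac).
  have d0 : 0 < rho - `|x0 - c (m s)| by rewrite subr_gt0.
  have /cvgrPdist_lt/(_ _ d0) := cc.
  apply: filterS => y /=; rewrite ltrBrDr addrC.
  by apply: le_lt_trans; rewrite (le_trans _ (ler_normD _ _))// addrA subrK.
(* Continuity of [c] at [m t] cannot be invoked, since [m t] is not yet known to lie in [dom c].
   Closedness decides: if [m t] were outside the image of the closed ball, so would be [m s] for
   close earlier [s]. At [t = 0] the starting point itself is in the image. *)
have mtN : (param c @` [set x | `|x0 - x| <= rho]) (m t).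
  apply: contrapT => nN.
  have : \forall s \near t, ~ (param c @` [set x | `|x0 - x| <= rho]) (m s).
    have oN : open (~` (param c @` [set x | `|x0 - x| <= rho])).
      by apply: closed_openC; apply: closed_param_ball => // y /ballU[].
    exact: (cm t _ (open_nbhs_nbhs (conj oN nN))).
  move=> /nbhs_ballP[d /= d0 Hd].
  move: t0; rewrite le_eqVlt => /orP[/eqP t0|t0].
    apply: nN; rewrite -t0 m0E; exists x => //=.
    exact: le_trans (ltW xe) erho.
  pose s := t - Num.min t d / 2.
  have md0 : 0 < Num.min t d by rewrite lt_min t0.
  have st : s < t by rewrite /s ltrBlDr ltrDl divr_gt0.
  have s0 : 0 <= s.
    by rewrite subr_ge0 ltW// half_lt// ge_min lexx.
  have [ds sr] := Ht s (introT andP (conj s0 st)).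
  apply: (Hd s); last first.
    exists (c (m s)); first exact: ltW.
    by rewrite (chart_coordK (chart_isP Ac) ds).
  rewrite /ball /= /s opprB addrC subrK ger0_norm; last by rewrite divr_ge0// ltW.
  by rewrite half_lt// ge_min lexx orbT.
have Hc s : 0 <= s <= t -> dom c (m s) /\ `|x0 - c (m s)| <= rho.
  case/andP=> s0; rewrite le_eqVlt => /orP[/eqP->|st]; last first.
    have [] := Ht s; first by rewrite s0.
    by move=> ds /ltW.
  case: mtN => y /= yr <-.
  have [[q dq qy] _] := ballU _ yr; rewrite -qy in yr *.
  by rewrite (chart_coordK (chart_isP Ac) dq).
have tt : 0 <= t <= t by rewrite t0 lexx.
have [dt _] := Hc t tt; split => //.
(* The mean value inequality is applied to each coordinate; the maximum norm reassembles them
   without loss. *)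
have dist : `|c (m t) - x| <= e * C.
  apply: rV_norm_le => [|j]; first by rewrite mulr_ge0// ltW.
  have := @MVT_bound R (fun s => c (m s) 0 j)
    (fun s => (\sum_i v 0 i *: action_field c i (c (m s))) 0 j) (e * C) t t0.
  rewrite m0E cmx.2 => mvt; rewrite !mxE; apply: le_trans (mvt _ _) _.
  - move=> s /Hc[ds _]; have [dm dmE] := is_derive_orbit Ac ds.
    apply: DeriveDef; first by have /derivable_mxP/(_ 0 j) := dm.
    by rewrite -dmE (derive_mx dm) mxE.
  - move=> s /Hc[ds /ballU[_ sb]].
    rewrite (le_trans (mx_coord_norm _ _ _))// (le_trans (ler_norm_sum _ _ _))//.
    rewrite mulr_sumr ler_sum// => i _; rewrite normrZ ler_pM//.
    exact: le_trans (mx_coord_norm _ _ _) (ltW ve).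
  by rewrite ler_piMr// mulr_ge0// ltW.
apply: le_lt_trans eC.
have -> : x0 - c (m t) = (x - c (m t)) + (x0 - x) by rewrite [RHS]addrC addrA subrK.
rewrite (le_trans (ler_normD _ _))// lerD//; first by rewrite distrC.
exact: ltW.
Qed.

Lemma lie_word_action_taylor l N psi x0 :
  smooth_on U (psi : _ -> R^o) -> U x0 ->
  exists2 C, 0 <= C & exists2 e, 0 < e &
  forall v x, `|v| < e -> `|x0 - x| < e ->
    let q := Lam (Exp v) (param c x) in
    dom c q /\
    `|lie_word (action_field c) l psi (c q) -
      \sum_(k < N) lie_word (action_field c) (l ++ nseq k v) psi x / k`!%:R|
      <= C * `|v| ^+ N.
Proof.
move=> spsi Ux0; have oU := open_chart_image Ac.
have [C C0 [r r0 Hr]] := lie_word_taylor oU (smooth_action_field Ac) l N spsi Ux0.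
have [e e0 He] := orbit_stays Ux0 r0.
have /nbhs_ballP[d d0 Hd] : \forall x \near x0, U x by exact: open_nbhs_nbhs.
exists C => //; exists (Num.min e d); first by rewrite lt_min e0.
move=> v x; rewrite !lt_min => /andP[ve _] /andP[xe xd] q.
have {}He := He v x ve xe.
have q1 : q = Lam (Exp ((1 : R) *: v)) (param c x) by rewrite scale1r.
have Ux : U x by apply: Hd; rewrite -ball_normE.
split; first by have [] := He 1; rewrite ?ler01 ?lexx// -q1.
have := Hr v (fun s => c (Lam (Exp (s *: v)) (param c x))).
rewrite -q1 scale0r Exp0 (action_one (problem_action P)).
have -> : c (param c x) = x.
  by case: Ux => p dp <-; rewrite (chart_coordK (chart_isP Ac) dp).
apply => s /He[ds sr]; split; first by rewrite -ball_normE.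
exact: is_derive_orbit.
Qed.
End NoEscape.

(** * Expansions in the step size *)

Section Asymptotics.
Context {R : realType}.
Implicit Types (f g k : R -> R) (N : nat).

(** The neighbourhood contains [h = 0]: for [N > 0] the values at 0 must agree, while [N = 0] only
    bounds the difference. *)
Definition eq_upto N f g := exists C, \forall h \near (0 : R), `|f h - g h| <= C * `|h| ^+ N.

Definition bnd f := eq_upto 0 f (fun=> 0).

Lemma eq_upto_refl N f : eq_upto N f f.
Proof.
by exists 0; near=> h; rewrite subrr normr0 mul0r.
Unshelve. all: by end_near. Qed.

Lemma eq_upto_sym N f g : eq_upto N f g -> eq_upto N g f.
Proof. by case=> C HC; exists C; apply: filterS HC => h; rewrite distrC. Qed.

Lemma eq_upto_trans N g f k : eq_upto N f g -> eq_upto N g k -> eq_upto N f k.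
Proof.
case=> C HC [D HD]; exists (C + D); apply: filterS2 HC HD => h hC hD.
rewrite -[f h](subrK (g h)) -addrA mulrDl (le_trans (ler_normD _ _))//.
exact: lerD.
Qed.

Lemma near_eq_upto N f g : (\forall h \near (0 : R), f h = g h) -> eq_upto N f g.
Proof. by move=> fg; exists 0; apply: filterS fg => h ->; rewrite subrr normr0 mul0r. Qed.

Lemma eq_upto_le N N' f g : (N <= N')%N -> eq_upto N' f g -> eq_upto N f g.
Proof.
move=> NN' [C HC]; exists `|C|.
have h1 : \forall h \near (0 : R), `|h| <= 1.
  apply/nbhs_ballP; exists 1 => //= h; rewrite /ball /= sub0r normrN; exact: ltW.
apply: filterS2 HC h1 => h hC h1; apply: le_trans hC _.
apply: le_trans (_ : `|C| * `|h| ^+ N' <= _); first by rewrite ler_wpM2r ?exprn_ge0// ler_norm.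
by rewrite ler_wpM2l// ler_wiXn2l.
Qed.

Lemma eq_uptoD N f f' g g' : eq_upto N f f' -> eq_upto N g g' ->
  eq_upto N (fun h => f h + g h) (fun h => f' h + g' h).
Proof.
case=> C HC [D HD]; exists (C + D); apply: filterS2 HC HD => h hC hD.
rewrite opprD addrACA mulrDl (le_trans (ler_normD _ _))//.
exact: lerD.
Qed.

Lemma eq_upto_sum N n (f g : 'I_n -> R -> R) : (forall i, eq_upto N (f i) (g i)) ->
  eq_upto N (fun h => \sum_(i < n) f i h) (fun h => \sum_(i < n) g i h).
Proof.
move=> fg; elim: n f g fg => [|n IH] f g fg.
  by apply: near_eq_upto; near=> h; rewrite !big_ord0.
apply: eq_upto_trans (_ : eq_upto N _
    (fun h => \sum_(i < n) f (widen_ord (leqnSn n) i) h + f ord_max h)) _.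
  by apply: near_eq_upto; near=> h; rewrite big_ord_recr.
apply: eq_upto_trans (eq_uptoD (IH _ (fun i => g (widen_ord (leqnSn n) i)) _) (fg ord_max)) _ => //.
by apply: near_eq_upto; near=> h; rewrite big_ord_recr.
Unshelve. all: by end_near. Qed.

Lemma bnd_le f N g : eq_upto N f g -> bnd g -> bnd f.
Proof. by move=> /(eq_upto_le (leq0n N)) fg; exact: eq_upto_trans. Qed.

Lemma bndP f : bnd f -> exists2 C, 0 <= C & \forall h \near (0 : R), `|f h| <= C.
Proof.
case=> C HC; exists `|C| => //; apply: filterS HC => h.
by rewrite subr0 expr0 mulr1 => /le_trans; apply; exact: ler_norm.
Qed.

Lemma eq_uptoM N f f' g g' : bnd f' -> bnd g' -> eq_upto N f f' -> eq_upto N g g' ->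
  eq_upto N (fun h => f h * g h) (fun h => f' h * g' h).
Proof.
move=> bf' bg' ff' gg'; have bf := bnd_le ff' bf'.
have [F F0 HF] := bndP bf; have [G G0 HG] := bndP bg'.
case: ff' => C HC; case: gg' => D HD; exists (G * C + F * D).
near=> h.
have -> : f h * g h - f' h * g' h = g' h * (f h - f' h) + f h * (g h - g' h) by ring.
rewrite (le_trans (ler_normD _ _))// !normrM mulrDl -!mulrA.
apply: lerD; apply: ler_pM => //; near: h => //.
Unshelve. all: by end_near. Qed.

Lemma eq_upto_shift N n f g : eq_upto N f g ->
  eq_upto (n + N) (fun h => h ^+ n * f h) (fun h => h ^+ n * g h).
Proof.
case=> C HC; exists C; apply: filterS HC => h hC.
by rewrite -mulrBr normrM normrX exprD mulrCA ler_wpM2l ?exprn_ge0.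
Qed.

Lemma eq_uptoZ N a f g : eq_upto N f g -> eq_upto N (fun h => a * f h) (fun h => a * g h).
Proof.
case=> C HC; exists (`|a| * C); apply: filterS HC => h hC.
by rewrite -mulrBr normrM -mulrA ler_wpM2l.
Qed.

Lemma bnd_cst (a : R) : bnd (fun=> a).
Proof.
by exists `|a|; near=> h; rewrite subr0 expr0 mulr1.
Unshelve. all: by end_near. Qed.

Lemma bnd_id : bnd id.
Proof.
exists 1; apply/nbhs_ballP; exists 1 => //= h; rewrite /ball /= sub0r normrN subr0 expr0 mulr1.
exact: ltW.
Qed.

Lemma bndD f g : bnd f -> bnd g -> bnd (fun h => f h + g h).
Proof.
move=> bf bg; apply: eq_upto_trans (eq_uptoD bf bg) _.
by apply: near_eq_upto; near=> h; rewrite addr0.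
Unshelve. all: by end_near. Qed.

Lemma bndM f g : bnd f -> bnd g -> bnd (fun h => f h * g h).
Proof.
move=> bf bg; apply: eq_upto_trans (eq_uptoM (bnd_cst 0) (bnd_cst 0) bf bg) _.
by apply: near_eq_upto; near=> h; rewrite mulr0.
Unshelve. all: by end_near. Qed.

Lemma bndX f n : bnd f -> bnd (fun h => f h ^+ n).
Proof.
move=> bf; elim: n => [|n IH]; first exact: bnd_cst.
by apply: eq_upto_trans (bndM bf IH); apply: near_eq_upto; near=> h; rewrite exprS.
Unshelve. all: by end_near. Qed.

Lemma bnd_continuous f : {for (0 : R), continuous f} -> bnd f.
Proof.
move=> /cvgrPdist_lt/(_ 1 ltr01) H; exists (`|f 0| + 1); apply: filterS H => h fh.
rewrite subr0 expr0 mulr1 -[f h](subrK (f 0)) addrC (le_trans (ler_normD _ _))// lerD2l.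
by rewrite distrC ltW.
Qed.

(** Reduces truncations to a polynomial identity with an explicit cofactor [k]. *)
Lemma eq_upto_remainder N k f g : bnd k ->
  (forall h, f h = g h + h ^+ N * k h) -> eq_upto N f g.
Proof.
move=> bk E; rewrite (_ : f = fun h => g h + h ^+ N * k h); last exact/funext.
apply: eq_upto_trans (eq_uptoD (eq_upto_refl N g) _) _; last first.
- apply: near_eq_upto; near=> h; exact: addr0.
- have := eq_upto_shift N bk; rewrite addn0 => /eq_upto_trans; apply.
  by apply: near_eq_upto; near=> h; rewrite mulr0.
Unshelve. all: by end_near. Qed.

Lemma MVT_bound_norm f (df : R -> R) (c t : R) :
  (forall s : R, `|s| <= `|t| -> is_derive s 1 f (df s)) ->
  (forall s, `|s| <= `|t| -> `|df s| <= c) ->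
  `|f t - f 0| <= c * `|t|.
Proof.
move=> fd dfc; have [t0|t0] := lerP 0 t.
  by rewrite ger0_norm// in fd dfc *; apply: MVT_bound => // s /andP[s0 st];
    [apply: fd|apply: dfc]; rewrite ger0_norm.
have nt s : s \in `[t, 0]%R -> `|s| <= `|t|.
  by rewrite in_itv /= => /andP[ts s0]; rewrite (ltr0_norm t0) (ler0_norm s0) lerN2.
have [||s st] := @MVT_segment R f df t 0 (ltW t0).
- by move=> s; rewrite in_itv /= => /andP[/ltW s0 /ltW st]; apply/fd/nt; rewrite in_itv /= s0.
- by apply: derivable_within_continuous => s /nt/fd[].
rewrite sub0r => E; rewrite distrC E normrM normrN ler_wpM2r// dfc//; exact: nt.
Qed.

(** The difference [f - g] vanishes at 0, so the mean value inequality plays the part of an integral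
    and gains one power. The derivative of [f] is asked for near 0 only, as solutions are local. *)
Lemma eq_upto_integrate N (f df g dg : R -> R) :
  f 0 = g 0 ->
  (\forall t \near (0 : R), is_derive (t : R) 1 f (df t)) ->
  (forall t : R, is_derive t 1 g (dg t)) ->
  eq_upto N df dg -> eq_upto N.+1 f g.
Proof.
move=> fg0 fd gd [C HC]; exists `|C|.
have /nbhs_ballP[e /= e0 He] : \forall t \near (0 : R),
    is_derive (t : R) 1 f (df t) /\ `|df t - dg t| <= C * `|t| ^+ N.
  by apply: filterI.
apply/nbhs_ballP; exists e => //= t; rewrite /ball /= sub0r normrN => te.
have Hs (s : R) : `|s| <= `|t| -> is_derive s 1 f (df s) /\ `|df s - dg s| <= C * `|s| ^+ N.
  by move=> st; apply: He; rewrite /ball /= sub0r normrN; exact: le_lt_trans te.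
have := @MVT_bound_norm (f \- g) (df \- dg) (`|C| * `|t| ^+ N) t.
rewrite /= fg0 subrr subr0 exprSr mulrA; apply.
  by move=> s /Hs[fs _]; exact: is_deriveB.
move=> s st; have [_ /le_trans] := Hs _ st; apply.
apply: le_trans (_ : `|C| * `|s| ^+ N <= _).
  by rewrite ler_wpM2r ?exprn_ge0// ler_norm.
by rewrite ler_wpM2l// lerXn2r ?nnegrE.
Qed.

End Asymptotics.

(** * Words as multilinear functions of their letters *)

Section WordAlgebra.
Context {R : realType} {n m : nat} (X : 'I_n -> 'rV[R]_m -> 'rV[R]_m).
Implicit Types (psi : 'rV[R]_m -> R) (u v w : 'rV[R]_n) (l : seq 'rV[R]_n).

(** Multilinearity in the letters turns a letter that is a polynomial in [h] into a polynomial whose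
    coefficients are words with constant letters. *)
Lemma lie_wordD l1 v w l2 psi x :
  lie_word X (l1 ++ (v + w) :: l2) psi x =
  lie_word X (l1 ++ v :: l2) psi x + lie_word X (l1 ++ w :: l2) psi x.
Proof.
elim: l1 psi => [|u l IH] psi /=.
  by rewrite -big_split; apply: eq_bigr => i _; rewrite mxE mulrDl.
by rewrite -big_split; apply: eq_bigr => i _; rewrite IH mulrDr.
Qed.

Lemma lie_wordZ l1 a v l2 psi x :
  lie_word X (l1 ++ (a *: v) :: l2) psi x = a * lie_word X (l1 ++ v :: l2) psi x.
Proof.
elim: l1 psi => [|u l IH] psi /=.
  by rewrite mulr_sumr; apply: eq_bigr => i _; rewrite mxE mulrA.
by rewrite mulr_sumr; apply: eq_bigr => i _; rewrite IH mulrCA.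
Qed.

Lemma lie_word_nseqZ l k a v psi x :
  lie_word X (l ++ nseq k (a *: v)) psi x = a ^+ k * lie_word X (l ++ nseq k v) psi x.
Proof.
elim: k l => [|k IH] l; first by rewrite expr0 mul1r.
by rewrite /= lie_wordZ -cat_rcons IH cat_rcons mulrA exprS.
Qed.

Definition eq_uptov N (v w : R -> 'rV[R]_n) :=
  forall i, eq_upto N (fun h => v h 0 i) (fun h => w h 0 i).

Definition bndv (v : R -> 'rV[R]_n) := forall i, bnd (fun h => v h 0 i).

Lemma bndv_le N (v w : R -> 'rV[R]_n) : eq_uptov N v w -> bndv w -> bndv v.
Proof. by move=> vw bw i; exact: bnd_le (vw i) (bw i). Qed.

Lemma bndv_norm (v : R -> 'rV[R]_n) : bndv v ->
  exists2 C, 0 < C & \forall h \near (0 : R), `|v h| <= C.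
Proof.
move=> bv.
have /choice[C HC] : forall i, exists C, 0 <= C /\ \forall h \near (0 : R), `|v h 0 i| <= C.
  by move=> i; have [C C0 HC] := bndP (bv i); exists C.
have C0 : 0 <= \sum_i C i by apply: sumr_ge0 => i _; have [] := HC i.
exists (\sum_i C i + 1); first by rewrite ltr_wpDl.
have := @filter_forall _ _ _ (nbhs (0 : R)) (nbhs_filter _) (fun i => (HC i).2).
apply: filterS => h Hh; apply: rV_norm_le => [|i]; first by rewrite addr_ge0.
rewrite (le_trans (Hh i))// (bigD1 i)//= -addrA lerDl addr_ge0// sumr_ge0// => j _.
by have [] := HC j.
Qed.

Lemma bnd_sum k (f : 'I_k -> R -> R) : (forall i, bnd (f i)) ->
  bnd (fun h => \sum_(i < k) f i h).
Proof.
move=> bf; apply: eq_upto_trans (eq_upto_sum bf) _.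
by apply: near_eq_upto; near=> h; rewrite big1.
Unshelve. all: by end_near. Qed.

Lemma bnd_lie_word l k psi x (v : R -> 'rV[R]_n) : bndv v ->
  bnd (fun h => lie_word X (l ++ nseq k (v h)) psi x).
Proof.
move=> bv; elim: l psi => [|u l IHl] psi.
  elim: k psi => [|k IHk] psi; first exact: bnd_cst.
  by apply: bnd_sum => i; apply: bndM => //; exact: IHk.
by apply: bnd_sum => i; apply: bndM; [exact: bnd_cst|exact: IHl].
Qed.

(** At a fixed point [x] the word is a polynomial in the components of its letters, so sums and
    products of expansions suffice. *)
Lemma eq_upto_lie_word l k N psi x (v w : R -> 'rV[R]_n) : eq_uptov N v w -> bndv w ->
  eq_upto N (fun h => lie_word X (l ++ nseq k (v h)) psi x)
        (fun h => lie_word X (l ++ nseq k (w h)) psi x).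
Proof.
move=> vw bw; elim: l psi => [|u l IHl] psi.
  elim: k psi => [|k IHk] psi; first exact: eq_upto_refl.
  apply: eq_upto_sum => i; apply: eq_uptoM; [exact: bw|exact: (@bnd_lie_word [::])|exact: vw|].
  exact: IHk.
apply: eq_upto_sum => i; apply: eq_uptoM; [exact: bnd_cst|exact: bnd_lie_word|exact: eq_upto_refl|].
exact: IHl.
Qed.

End WordAlgebra.

(** * One exponential applied at a moving base point *)

Section Stages.
Context {R : realType} (P : lie_problem R) (c : chart (M P) 'rV[R]_(dimM P)).
Hypothesis Ac : atlasM c.
Let U : set 'rV[R]_(dimM P) := c @` dom c.
Local Notation word := (lie_word (action_field c)).
Implicit Types (psi : 'rV[R]_(dimM P) -> R) (q : R -> M P) (w : R -> 'rV[R]_(dimG P)).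

(** Membership in [dom c] is included because closeness of junk coordinates would say nothing about
    the point. *)
Definition tends_to_coord q (x0 : 'rV[R]_(dimM P)) := forall r, 0 < r ->
  \forall h \near (0 : R), dom c (q h) /\ `|x0 - c (q h)| < r.

Lemma tends_to_coord_cst p : dom c p -> tends_to_coord (fun=> p) (c p).
Proof.
by move=> dp r r0; near=> h; rewrite subrr normr0.
Unshelve. all: by end_near. Qed.

Lemma near_small_step w e : bndv w -> 0 < e -> \forall h \near (0 : R), `|h *: w h| < e.
Proof.
move=> bw e0; have [C C0 HC] := bndv_norm bw.
have He : \forall h \near (0 : R), `|h| < e / C.
  apply/nbhs_ballP; exists (e / C); first exact: divr_gt0.
  by move=> h; rewrite /ball /= sub0r normrN.
apply: filterS2 HC He => h hC he; rewrite normrZ.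
by rewrite (le_lt_trans (ler_wpM2l (normr_ge0 h) hC))// -ltr_pdivlMr.
Qed.

Lemma tends_to_coord_exp w q x0 : U x0 -> bndv w -> tends_to_coord q x0 ->
  tends_to_coord (fun h => Lam (Exp (h *: w h)) (q h)) x0.
Proof.
move=> Ux0 bw tq r r0; have [e e0 He] := orbit_stays Ac Ux0 r0.
apply: filterS2 (tq _ e0) (near_small_step bw e0) => h [dq xq] wh.
have := He _ _ wh xq 1; rewrite ler01 lexx scale1r => /(_ isT).
by rewrite (chart_coordK (chart_isP Ac) dq).
Qed.

(** The base point may move with [h] because the Taylor constant is uniform near [x0]. Homogeneity
    extracts [h ^+ k] from the block of [k] letters, and a bound [D] on [w] turns the remainder into
    [C * D ^+ N * |h| ^+ N]. *)
Lemma eq_upto_exp_stage l N psi w q x0 : smooth_on U (psi : _ -> R^o) -> U x0 ->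
  bndv w -> tends_to_coord q x0 ->
  eq_upto N (fun h => word l psi (c (Lam (Exp (h *: w h)) (q h))))
    (fun h => \sum_(k < N) h ^+ k * (word (l ++ nseq k (w h)) psi (c (q h)) / k`!%:R)).
Proof.
move=> spsi Ux0 bw tq; have [C C0 [e e0 He]] := lie_word_action_taylor Ac l N spsi Ux0.
have [D D0 HD] := bndv_norm bw.
exists (C * D ^+ N).
apply: filterS3 HD (tq _ e0) (near_small_step bw e0) => h hD [dq xq] wh.
have [_] := He _ _ wh xq.
rewrite (chart_coordK (chart_isP Ac) dq).
rewrite (eq_bigr (fun k : 'I_N => h ^+ k * (word (l ++ nseq k (w h)) psi (c (q h)) / k`!%:R))).
  move/le_trans; apply; rewrite -mulrA ler_wpM2l// normrZ exprMn [leRHS]mulrC.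
  by rewrite ler_wpM2l ?exprn_ge0// lerXn2r ?nnegrE// ltW.
by move=> k _; rewrite lie_word_nseqZ mulrA.
Qed.
End Stages.

Ltac bnd_poly :=
  do !(apply: bndD || apply: bndM || apply: bnd_cst || apply: bnd_id || apply: bndX).

Lemma is_derive_cubic (R : realType) (a b c d t : R) :
  is_derive t 1 (fun s : R => a + s * b + s ^+ 2 * c + s ^+ 3 * d)
    (b + t * (2 * c) + t ^+ 2 * (3 * d)).
Proof.
have -> : (fun s : R => a + s * b + s ^+ 2 * c + s ^+ 3 * d) =
    horner (a%:P + b *: 'X + c *: 'X^2 + d *: 'X^3).
  by apply/funext => s; rewrite !(hornerD, hornerC, hornerZ, hornerX, hornerXn); ring.
apply: is_derive_eq.
rewrite !poly.derivE !(mulr1, mul1r) -polyC1.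
by rewrite !(hornerD, hornerC, hornerZ, hornerM, hornerX); ring.
Qed.

Lemma eq_upto_sum_prod (R : realType) n (a b c a' b' c' : 'I_n -> R) :
  eq_upto 3
    (fun t : R => \sum_(i < n) (a i + t * b i + t ^+ 2 * c i) * (a' i + t * b' i + t ^+ 2 * c' i))
    (fun t => (\sum_(i < n) a i * a' i) + t * (\sum_(i < n) (a i * b' i + b i * a' i))
       + t ^+ 2 * (\sum_(i < n) (a i * c' i + b i * b' i + c i * a' i))).
Proof.
(* The cofactor collects the coefficients of [t ^+ 3] and [t ^+ 4] of the product. *)
apply: (@eq_upto_remainder _ _
    (fun t => (\sum_(i < n) (b i * c' i + c i * b' i)) + t * (\sum_(i < n) c i * c' i))).
  by bnd_poly.
move=> t; rewrite !mulr_sumr -!big_split /=  mulr_sumr -!big_split /=.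
by apply: eq_bigr => i _; ring.
Qed.

Lemma sum_cubic_terms (R : realType) n (a b b' e k g g' d : 'I_n -> R) :
  \sum_(i < n) (a i * ((b i + b' i) / 2) + e i * k i + (g i + g' i) / 2 * d i) =
  (\sum_(i < n) a i * b i + \sum_(i < n) a i * b' i) / 2 + \sum_(i < n) e i * k i
  + (\sum_(i < n) g i * d i + \sum_(i < n) g' i * d i) / 2.
Proof.
rewrite -!big_split /= !mulr_suml -!big_split /=.
by apply: eq_bigr => i _; field.
Qed.

Ltac abstract_words := repeat
  match goal with |- context [lie_word ?X ?l ?psi ?x] =>
    let a := fresh "a" in generalize (lie_word X l psi x) => a end.

(** * Expansions of the exact flow and of the scheme *)

Section Expansions.
Context {R : realType} (P : lie_problem R) (c : chart (M P) 'rV[R]_(dimM P)).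
Hypothesis Ac : atlasM c.
Variable p : M P.
Hypothesis dp : dom c p.

Let U : set 'rV[R]_(dimM P) := c @` dom c.
Local Notation word l psi := (lie_word (action_field c) l psi (c p)).
Local Notation smooth psi := (smooth_on U (psi : 'rV[R]_(dimM P) -> R^o)).
Implicit Types (psi : 'rV[R]_(dimM P) -> R).

Definition f_coord (i : 'I_(dimG P)) (x : 'rV[R]_(dimM P)) : R := f (param c x) 0 i.

Let u : 'rV[R]_(dimG P) := f p.
(* [u1] is the derivative of [f] along the solution at [p]; its second derivative
   is [u11 + ud], where [u11] comes from keeping the value of [f] frozen and [ud]
   from its variation. *)
Let u1 : 'rV[R]_(dimG P) := \row_i word [:: u] (f_coord i).
Let u11 : 'rV[R]_(dimG P) := \row_i word [:: u; u] (f_coord i).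
Let ud : 'rV[R]_(dimG P) := \row_i word [:: u1] (f_coord i).

(** The derivatives of [psi] along the solution, divided by factorials. In the third one, the [f] of
    the inner slot may be differentiated before or after the outer slot appears, that of the outer
    slot only after: hence weight 2 for [[:: u1; u]] against 1 for [[:: u; u1]]. *)
Definition third_order_jet psi (t : R) :=
  psi (c p) + t * word [:: u] psi + t ^+ 2 * ((word [:: u1] psi + word [:: u; u] psi) / 2)
  + t ^+ 3 * ((word [:: ud] psi + word [:: u11] psi + 2 * word [:: u1; u] psi
               + word [:: u; u1] psi + word [:: u; u; u] psi) / 6).

Lemma cp_image : U (c p). Proof. by exists p. Qed.

Lemma smooth_f_coord i : smooth (f_coord i).
Proof.
have [_ sf] := problem_f P; move=> k.
apply: Ck_coord; first exact: open_chart_image.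
suff -> : U = c @` (dom c `&` @f R P @^-1` dom (Chart setT id id : chart _ 'rV[R]_(dimG P))).
  exact: (sf c (Chart setT id id) Ac).
by rewrite /= preimage_setT setIT.
Qed.

Lemma smooth_coord_rep (psi : M P -> R^o) :
  smooth_map (@atlasM R P) (@vec_atlas R R^o) psi -> smooth (psi \o param c).
Proof.
case=> _ sf; move=> k.
suff -> : U = c @` (dom c `&` psi @^-1` dom (Chart setT id id : chart _ R^o)).
  exact: (sf c (Chart setT id id) Ac).
by rewrite /= preimage_setT setIT.
Qed.

Lemma f_coord_p i : f_coord i (c p) = u 0 i.
Proof. by rewrite /f_coord (chart_coordK (chart_isP Ac) dp). Qed.

(** * Expansion of the exact flow *)

Section ExactFlow.
Variable phi : R -> M P -> M P.
Hypothesis Hphi : is_exact_flow phi.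
Let eta t := c (phi t p).

Lemma near_flow : \forall t \near (0 : R), dom c (phi t p) /\
  is_derive (t : R) 1 eta (\sum_i f (phi t p) 0 i *: action_field c i (eta t)).
Proof.
have [p0 nphi] := Hphi p.
have nd : \forall t \near (0 : R), dom c (phi t p).
  have [c0 _] := nbhs_singleton nphi.
  apply: c0; rewrite p0; apply: open_nbhs_nbhs; split => //.
  exact: chart_open_dom (chart_isP Ac).
apply: filterS2 nd nphi => t dt [_ /(_ c Ac dt)].
by rewrite (inf_actionE Ac _ dt).
Qed.

Lemma eta0 : eta 0 = c p. Proof. by rewrite /eta (Hphi p).1. Qed.

Lemma is_derive_flow psi : smooth psi -> \forall t \near (0 : R),
  is_derive (t : R) 1 (psi \o eta)
    (\sum_i f_coord i (eta t) * lie_deriv (action_field c) i psi (eta t)).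
Proof.
move=> spsi; apply: filterS near_flow => t [dt de].
have Ut : U (eta t) by exists (phi t p).
have := is_derive_lie_deriv spsi Ut de.
by rewrite /f_coord /eta (chart_coordK (chart_isP Ac) dt).
Qed.

(** One Picard iteration. The coefficients [a], [b], [e] are functionals because the current
    expansion is applied both to the components of [f] and to the derivatives of [psi]. *)
Lemma flow_step N (a b e : ('rV[R]_(dimM P) -> R) -> R) :
  (forall psi, smooth psi ->
    eq_upto N (psi \o eta) (fun t => a psi + t * b psi + t ^+ 2 * e psi)) ->
  forall psi b' c' d', smooth psi ->
  eq_upto N (fun t => \sum_i (a (f_coord i) + t * b (f_coord i) + t ^+ 2 * e (f_coord i)) *
      (a (lie_deriv (action_field c) i psi) + t * b (lie_deriv (action_field c) i psi)
        + t ^+ 2 * e (lie_deriv (action_field c) i psi)))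
    (fun t => b' + t * c' + t ^+ 2 * d') ->
  eq_upto N.+1 (psi \o eta)
    (fun t => psi (c p) + t * b' + t ^+ 2 * (c' / 2) + t ^+ 3 * (d' / 3)).
Proof.
move=> H psi b' c' d' spsi Hs.
apply: (eq_upto_integrate (dg := fun t => b' + t * (2 * (c' / 2)) + t ^+ 2 * (3 * (d' / 3)))
  _ (is_derive_flow spsi)).
- by rewrite /= eta0 mul0r !expr0n /= !mul0r !addr0.
- by move=> t; exact: is_derive_cubic.
apply: (eq_upto_trans (g := fun t => \sum_i (a (f_coord i) + t * b (f_coord i) + t ^+ 2 * e (f_coord i)) *
      (a (lie_deriv (action_field c) i psi) + t * b (lie_deriv (action_field c) i psi)
        + t ^+ 2 * e (lie_deriv (action_field c) i psi)))).
  apply: eq_upto_sum => i.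
  have bq psi' : bnd (fun t => a psi' + t * b psi' + t ^+ 2 * e psi').
    by bnd_poly.
  apply: eq_uptoM => //; apply: H; first exact: smooth_f_coord.
  by apply: smooth_lie_deriv => //; [exact: open_chart_image|exact: smooth_action_field].
apply: eq_upto_trans Hs _; apply: near_eq_upto; near=> t; field.
Unshelve. all: by end_near. Qed.

Lemma flow_expansion psi : smooth psi -> eq_upto 4 (psi \o eta) (third_order_jet psi).
Proof.
(* Order 0 is mere boundedness of the solution; the zero coefficients keep the quadratic shape that
   [flow_step] expects. Each further round gains one order. *)
have H0 psi' : smooth psi' -> eq_upto 0 (psi' \o eta) (fun t => psi' (c p) + t * 0 + t ^+ 2 * 0).
  move=> spsi; have [_ de] := nbhs_singleton near_flow.
  apply: eq_upto_trans (_ : eq_upto 0 _ (fun=> 0)) (eq_upto_sym _); last first.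
    by bnd_poly.
  apply: bnd_continuous; apply: continuous_comp.
    by apply: differentiable_continuous; apply/derivable1_diffP; case: de.
  by rewrite eta0; apply: (smooth_continuous spsi); exact: cp_image.
have H1 psi' : smooth psi' -> eq_upto 1 (psi' \o eta) (fun t => psi' (c p) + t * 0 + t ^+ 2 * 0).
  move=> spsi.
  have Hs : eq_upto 0 (fun t : R => \sum_i (f_coord i (c p) + t * 0 + t ^+ 2 * 0) *
     (lie_deriv (action_field c) i psi' (c p) + t * 0 + t ^+ 2 * 0)) (fun t => 0 + t * 0 + t ^+ 2 * 0).
    apply: eq_upto_trans (_ : eq_upto 0 _ (fun=> 0)) (eq_upto_sym _); last first.
      by bnd_poly.
    by apply: bnd_sum => i; bnd_poly.
  apply: eq_upto_trans (flow_step H0 spsi Hs) _.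
  by apply: near_eq_upto; near=> t; field.
have H2 psi' : smooth psi' -> eq_upto 2 (psi' \o eta)
    (fun t => psi' (c p) + t * word [:: u] psi' + t ^+ 2 * 0).
  move=> spsi.
  have Hs : eq_upto 1 (fun t : R => \sum_i (f_coord i (c p) + t * 0 + t ^+ 2 * 0) *
     (lie_deriv (action_field c) i psi' (c p) + t * 0 + t ^+ 2 * 0))
     (fun t => word [:: u] psi' + t * 0 + t ^+ 2 * 0).
    apply: near_eq_upto; near=> t; rewrite !mulr0 !addr0 /=.
    by apply: eq_bigr => i _; rewrite ?mulr0 !addr0 f_coord_p.
  apply: eq_upto_trans (flow_step H1 spsi Hs) _.
  by apply: near_eq_upto; near=> t; field.
have H3 psi' : smooth psi' -> eq_upto 3 (psi' \o eta)
    (fun t => psi' (c p) + t * word [:: u] psi'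
       + t ^+ 2 * ((word [:: u1] psi' + word [:: u; u] psi') / 2)).
  move=> spsi.
  have Hs := eq_upto_sum_prod (fun i => f_coord i (c p))
    (fun i => word [:: u] (f_coord i)) (fun=> 0)
    (fun i => lie_deriv (action_field c) i psi' (c p))
    (fun i => word [:: u] (lie_deriv (action_field c) i psi')) (fun=> 0).
  apply: eq_upto_trans (flow_step H2 spsi (eq_upto_le (isT : 2 <= 3)%N Hs)) _.
  apply: (eq_upto_remainder (k := fun=> (\sum_i (f_coord i (c p) * 0 +
    word [:: u] (f_coord i) * word [:: u] (lie_deriv (action_field c) i psi') +
    0 * lie_deriv (action_field c) i psi' (c p))) / 3)).
    exact: bnd_cst.
  move=> t; congr (_ + _); rewrite big_split /= addrC; congr (_ + _ * _ + _ * ((_ + _) / 2)).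
  - by apply: eq_bigr => i _; rewrite f_coord_p.
  - by apply: eq_bigr => i _; rewrite mxE.
  - by apply: eq_bigr => i _; rewrite f_coord_p.
move=> spsi.
have Hs := eq_upto_sum_prod (fun i => f_coord i (c p)) (fun i => word [:: u] (f_coord i))
  (fun i => (word [:: u1] (f_coord i) + word [:: u; u] (f_coord i)) / 2)
  (fun i => lie_deriv (action_field c) i psi (c p))
  (fun i => word [:: u] (lie_deriv (action_field c) i psi))
  (fun i => (word [:: u1] (lie_deriv (action_field c) i psi) +
             word [:: u; u] (lie_deriv (action_field c) i psi)) / 2).
apply: eq_upto_trans (flow_step H3 spsi Hs) _.
apply: near_eq_upto; near=> t; rewrite /third_order_jet.
have -> : \sum_i f_coord i (c p) * lie_deriv (action_field c) i psi (c p) = word [:: u] psi.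
  by apply: eq_bigr => i _; rewrite f_coord_p.
have -> : \sum_i (f_coord i (c p) * word [:: u] (lie_deriv (action_field c) i psi) +
    word [:: u] (f_coord i) * lie_deriv (action_field c) i psi (c p)) =
    word [:: u; u] psi + word [:: u1] psi.
  rewrite big_split; congr (_ + _); apply: eq_bigr => i _; by rewrite ?f_coord_p ?mxE.
have -> : \sum_i (f_coord i (c p) * ((word [:: u1] (lie_deriv (action_field c) i psi) +
             word [:: u; u] (lie_deriv (action_field c) i psi)) / 2) +
    word [:: u] (f_coord i) * word [:: u] (lie_deriv (action_field c) i psi) +
    (word [:: u1] (f_coord i) + word [:: u; u] (f_coord i)) / 2 *
      lie_deriv (action_field c) i psi (c p)) =
    (word [:: u; u1] psi + word [:: u; u; u] psi) / 2 + word [:: u1; u] psi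
     + (word [:: ud] psi + word [:: u11] psi) / 2.
  rewrite sum_cubic_terms.
  by congr ((_ + _) / 2 + _ + (_ + _) / 2); apply: eq_bigr => i _; rewrite ?f_coord_p ?mxE.
by abstract_words; field.
Unshelve. all: by end_near. Qed.

End ExactFlow.

(** * Expansions of an exponential, of [f] and of the second stage *)

Lemma eq_upto_trunc3 (a b e d : R) :
  eq_upto 3 (fun h => a + h * b + h ^+ 2 * e + h ^+ 3 * d) (fun h => a + h * b + h ^+ 2 * e).
Proof. by apply: (eq_upto_remainder (k := fun=> d)); [exact: bnd_cst|move=> h; ring]. Qed.

Lemma eq_upto_trunc2 (a b e d : R) :
  eq_upto 2 (fun h => a + h * b + h ^+ 2 * e + h ^+ 3 * d) (fun h => a + h * b).
Proof.
apply: (eq_upto_remainder (k := fun h => e + h * d)) => [|h]; last by ring.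
by bnd_poly.
Qed.

Lemma eq_upto_trunc1 (a b e d : R) :
  eq_upto 1 (fun h => a + h * b + h ^+ 2 * e + h ^+ 3 * d) (fun=> a).
Proof.
apply: (eq_upto_remainder (k := fun h => b + h * e + h ^+ 2 * d)) => [|h]; last by ring.
by bnd_poly.
Qed.

Implicit Types (v w : 'rV[R]_(dimG P)) (l : seq 'rV[R]_(dimG P)).

Definition quad (w0 w1 w2 : 'rV[R]_(dimG P)) (h : R) := w0 + h *: w1 + h ^+ 2 *: w2.

Lemma quadE w0 w1 w2 h i : quad w0 w1 w2 h 0 i = w0 0 i + h * w1 0 i + h ^+ 2 * w2 0 i.
Proof. by rewrite !mxE. Qed.

Lemma bndv_quad w0 w1 w2 : bndv (quad w0 w1 w2).
Proof.
move=> i; rewrite (_ : (fun h => _) = fun h => w0 0 i + h * w1 0 i + h ^+ 2 * w2 0 i).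
  by bnd_poly.
by apply/funext => h; exact: quadE.
Qed.

Lemma quad_trunc2 w0 w1 w2 : eq_uptov 2 (quad w0 w1 w2) (quad w0 w1 0).
Proof.
move=> i; apply: (eq_upto_remainder (k := fun=> w2 0 i)); first exact: bnd_cst.
by move=> h; rewrite !quadE mxE; ring.
Qed.

Lemma quad_trunc1 w0 w1 w2 : eq_uptov 1 (quad w0 w1 w2) (quad w0 0 0).
Proof.
move=> i; apply: (eq_upto_remainder (k := fun h => w1 0 i + h * w2 0 i)).
  by bnd_poly.
by move=> h; rewrite !quadE !mxE; ring.
Qed.

Lemma eq_uptov_trans N (v w z : R -> 'rV[R]_(dimG P)) :
  eq_uptov N v w -> eq_uptov N w z -> eq_uptov N v z.
Proof. by move=> vw wz i; exact: eq_upto_trans (wz i). Qed.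

Lemma eq_uptov_le N N' (v w : R -> 'rV[R]_(dimG P)) :
  (N <= N')%N -> eq_uptov N' v w -> eq_uptov N v w.
Proof. by move=> NN' vw i; exact: eq_upto_le (vw i). Qed.

(** The exponential series at [w0 + h w1 + h^2 w2], collected by powers of [h]. A single exponential
    weighs [[:: w0; w1]] and [[:: w1; w0]] equally; the asymmetry of the flow needs a second
    factor. *)
Definition exp_jet l psi w0 w1 w2 (h : R) :=
  word l psi + h * word (l ++ [:: w0]) psi
  + h ^+ 2 * (word (l ++ [:: w1]) psi + word (l ++ [:: w0; w0]) psi / 2)
  + h ^+ 3 * (word (l ++ [:: w2]) psi
      + (word (l ++ [:: w0; w1]) psi + word (l ++ [:: w1; w0]) psi) / 2
      + word (l ++ [:: w0; w0; w0]) psi / 6).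

(** A block of [k] letters comes with [h ^+ k], so there [w] matters only up to order [N.+1 - k];
    hence the shorter truncations of [quad] for [k = 2] and [k = 3]. *)
Lemma exp_expansion N l psi (w : R -> 'rV[R]_(dimG P)) w0 w1 w2 :
  (N <= 3)%N -> smooth psi -> eq_uptov N w (quad w0 w1 w2) ->
  eq_upto N.+1 (fun h => lie_word (action_field c) l psi (c (Lam (Exp (h *: w h)) p)))
    (exp_jet l psi w0 w1 w2).
Proof.
move=> N3 spsi wW.
have bw := bndv_le wW (bndv_quad w0 w1 w2).
have E := eq_upto_exp_stage Ac l 4 spsi cp_image bw (tends_to_coord_cst dp).
apply: eq_upto_trans (eq_upto_le (N3 : (N.+1 <= 4)%N) E) _.
apply: (eq_upto_trans (g := fun h => word l psi + h ^+ 1 * word (l ++ nseq 1 (w h)) psi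
    + 1 / 2 * (h ^+ 2 * word (l ++ nseq 2 (w h)) psi)
    + 1 / 6 * (h ^+ 3 * word (l ++ nseq 3 (w h)) psi))).
  apply: near_eq_upto; near=> h; rewrite !big_ord_recl big_ord0 cats0.
  have -> : (2`! = 2)%N by [].
  have -> : (3`! = 6)%N by [].
  rewrite fact0 (_ : 1`! = 1%N) //.
  rewrite /= /bump /= !add1n expr0 divr1 mul1r addr0 !addrA !divr1.
  by congr (_ + _ + _ + _); rewrite div1r mulrA mulrC.
have t1 := eq_upto_shift 1 (@eq_upto_lie_word _ _ _ (action_field c) l 1 _
  psi (c p) _ _ wW (bndv_quad _ _ _)).
have w2W := eq_uptov_trans (eq_uptov_le (geq_minl N 2) wW)
  (eq_uptov_le (geq_minr N 2) (quad_trunc2 _ _ _)).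
have t2 := eq_upto_shift 2 (@eq_upto_lie_word _ _ _ (action_field c) l 2 _
  psi (c p) _ _ w2W (bndv_quad _ _ _)).
have w1W := eq_uptov_trans (eq_uptov_le (geq_minl N 1) wW)
  (eq_uptov_le (geq_minr N 1) (quad_trunc1 _ _ _)).
have t3 := eq_upto_shift 3 (@eq_upto_lie_word _ _ _ (action_field c) l 3 _
  psi (c p) _ _ w1W (bndv_quad _ _ _)).
have m2 : (N.+1 <= 2 + minn N 2)%N by case: N N3 {wW E t1 w2W t2 w1W t3} => [|[|[|[|]]]].
have m3 : (N.+1 <= 3 + minn N 1)%N by case: N N3 {wW E t1 w2W t2 w1W t3 m2} => [|[|[|[|]]]].
apply: eq_upto_trans (eq_uptoD (eq_uptoD (eq_uptoD (eq_upto_refl _ _) t1)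
  (eq_uptoZ (1 / 2) (eq_upto_le m2 t2))) (eq_uptoZ (1 / 6) (eq_upto_le m3 t3))) _.
apply: (eq_upto_le (N3 : (N.+1 <= 4)%N)).
(* After these truncations the only term beyond the jet is the product of the two [h *: w1] in the
   block of length 2, at [h ^ 4]. *)
apply: (eq_upto_remainder (k := fun=> word (l ++ [:: w1; w1]) psi / 2)); first exact: bnd_cst.
move=> h; rewrite /exp_jet /quad !scaler0 !addr0 /= !lie_wordD !lie_wordZ.
rewrite -!(cat_rcons w0 l) -!(cat_rcons w1 l) !lie_wordD !lie_wordZ !cat_rcons.
by abstract_words; field.
Unshelve. all: by end_near. Qed.

Definition f_words l : 'rV[R]_(dimG P) := \row_i word l (f_coord i).

Lemma lie_word1D psi v w : word [:: v + w] psi = word [:: v] psi + word [:: w] psi.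
Proof. exact: (lie_wordD _ [::]). Qed.

Lemma lie_word1Z psi (x : R) v : word [:: x *: v] psi = x * word [:: v] psi.
Proof. exact: (lie_wordZ _ [::]). Qed.

Lemma lie_word2Z psi (x y : R) v w :
  word [:: x *: v; y *: w] psi = x * (y * word [:: v; w] psi).
Proof. by rewrite (lie_wordZ _ [::]) (lie_wordZ _ [:: v]). Qed.

Lemma lie_word3Z psi (x y z : R) v w v' :
  word [:: x *: v; y *: w; z *: v'] psi = x * (y * (z * word [:: v; w; v'] psi)).
Proof. by rewrite (lie_wordZ _ [::]) (lie_wordZ _ [:: v]) (lie_wordZ _ [:: v; w]). Qed.

Lemma lie_word10 psi : word [:: 0] psi = 0.
Proof. by rewrite -(scale0r 0) lie_word1Z mul0r. Qed.

Lemma f_expansion N (w : R -> 'rV[R]_(dimG P)) w0 w1 w2 :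
  (N <= 2)%N -> eq_uptov N w (quad w0 w1 w2) ->
  eq_uptov N.+1 (fun h => f (Lam (Exp (h *: w h)) p))
    (quad u (f_words [:: w0]) (f_words [:: w1] + 2^-1 *: f_words [:: w0; w0])).
Proof.
move=> N2 wW i; have bw := bndv_le wW (bndv_quad w0 w1 w2).
have N3 : (N <= 3)%N by apply: leq_trans N2 _.
apply: (eq_upto_trans (g := fun h => f_coord i (c (Lam (Exp (h *: w h)) p)))).
  apply: near_eq_upto.
  have := tends_to_coord_exp Ac cp_image bw (tends_to_coord_cst dp) ltr01.
  apply: filterS => h [dh _].
  by rewrite /f_coord (chart_coordK (chart_isP Ac) dh).
apply: eq_upto_trans (@exp_expansion N [::] _ _ _ _ _ N3 (smooth_f_coord i) wW) _.
apply: eq_upto_trans (eq_upto_le (N2 : (N.+1 <= 3)%N) (eq_upto_trunc3 _ _ _ _)) _.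
apply: near_eq_upto; near=> h.
by rewrite quadE !mxE /= f_coord_p [2^-1 * _]mulrC.
Unshelve. all: by end_near. Qed.

Lemma eq_uptov_affine N (x y : R) v (w z w' z' : R -> 'rV[R]_(dimG P)) :
  eq_uptov N w w' -> eq_uptov N z z' ->
  eq_uptov N (fun h => v + x *: w h + y *: z h) (fun h => v + x *: w' h + y *: z' h).
Proof.
move=> ww zz i.
have E (w1 z1 : R -> 'rV[R]_(dimG P)) : (fun h => (v + x *: w1 h + y *: z1 h) 0 i) =
    fun h => v 0 i + x * w1 h 0 i + y * z1 h 0 i by apply/funext => h; rewrite !mxE.
by rewrite !E; apply: eq_uptoD; [apply: eq_uptoD; [exact: eq_upto_refl|]|]; apply: eq_uptoZ.
Qed.

Lemma f1E : f1 p = u.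
Proof. by rewrite /f1 (action_one (problem_action P)). Qed.

Lemma third_stepE (h : R) : - (h / 3) *: f1 p = h *: ((- (1 / 3)) *: u).
Proof. by rewrite f1E scalerA; congr (_ *: _); field. Qed.

Lemma eq_uptov_cst N v : eq_uptov N (fun=> v) (quad v 0 0).
Proof.
by move=> i; apply: near_eq_upto; near=> h; rewrite quadE !mxE !mulr0 !addr0.
Unshelve. all: by end_near. Qed.

(** [1 / 18] is half the square of the abscissa [- (1 / 3)]; no [ud] appears because the exponent is
    a constant multiple of [u]. *)
Lemma f2_expansion :
  eq_uptov 3 (fun h => f2 h p) (quad u ((- (1 / 3)) *: u1) ((1 / 18) *: u11)).
Proof.
have -> : (fun h => f2 h p) = fun h => f (Lam (Exp (h *: ((- (1 / 3)) *: u))) p).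
  by apply/funext => h; rewrite /f2 /g2 third_stepE.
apply: eq_uptov_trans (f_expansion (isT : 2 <= 2)%N (eq_uptov_cst _ _)) _.
move=> i; apply: near_eq_upto; near=> h; rewrite !quadE !mxE.
by rewrite lie_word1Z lie_word10 lie_word2Z; abstract_words; field.
Unshelve. all: by end_near. Qed.

(** * The scheme and its embedded approximation *)

Section Method.
Variables a delta : R.
Hypothesis a0 : a != 0.
Hypothesis delta_root : 4 * a * delta ^+ 2 + (12 * a - 2) * delta + (9 * a + 6) = 0.

(** The abscissa of the third stage: the sum of the coefficients of f_1 and f_2 in g_3. *)
Let c3 := - (2 * a * delta / 3) - 2 * a + a.

(** The coefficient of [ud] is the weight [a] of f_2 in g_3 times its first-order coefficient
    [- (1 / 3)]; f_3 is the only stage value in which [ud] occurs. *)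
Lemma f3_expansion :
  eq_uptov 3 (fun h => f3 a delta h p)
    (quad u (c3 *: u1) ((- (a / 3)) *: ud + (c3 ^+ 2 / 2) *: u11)).
Proof.
pose k1 := - (2 * a * delta / 3) - 2 * a.
have W : eq_uptov 2 (fun h => k1 *: f1 p + a *: f2 h p)
    (quad (c3 *: u) ((- (a / 3)) *: u1) ((a / 18) *: u11)).
  have := eq_uptov_affine a 0 (k1 *: u)
    (eq_uptov_le (isT : 2 <= 3)%N f2_expansion) (fun=> eq_upto_refl 2 _) (z := fun=> 0).
  move=> H i; apply: eq_upto_trans (eq_upto_trans (H i) _); apply: near_eq_upto; near=> h.
    by rewrite scaler0 addr0 f1E.
  by rewrite !(mxE, quadE) /c3 /k1; abstract_words; field.
apply: eq_uptov_trans (f_expansion (isT : 2 <= 2)%N W) _.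
move=> i; apply: near_eq_upto; near=> h; rewrite !quadE !mxE.
by rewrite !lie_word1Z lie_word2Z; abstract_words; field.
Unshelve. all: by end_near. Qed.

Definition update_vec (h : R) := ((- 6 * a * delta + 8 * a + 3) / (6 * a)) *: f1 p
               + delta *: f2 h p - (1 / (2 * a)) *: f3 a delta h p.

(** [4 / 3] compensates the reused exponential of [- (1 / 3) *: u]. Only the present factor brings
    letters other than [u], so [1 / 2] and [1 / 6] must be the weights of the one-letter words in
    [third_order_jet]. *)
Lemma update_expansion : eq_uptov 3 update_vec
  (quad ((4 / 3) *: u) ((1 / 2) *: u1) ((1 / 6) *: (ud + u11))).
Proof.
(* The order conditions; the last one is equivalent to the equation for [delta]. *)
have E1 : (- 6 * a * delta + 8 * a + 3) / (6 * a) + delta - 1 / (2 * a) = 4 / 3 by field.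
have E2 : - delta / 3 - c3 / (2 * a) = 1 / 2 by rewrite /c3; field.
have E3 : delta / 18 - c3 ^+ 2 / (4 * a) = 1 / 6.
  have -> : delta / 18 - c3 ^+ 2 / (4 * a) =
    1 / 6 - (4 * a * delta ^+ 2 + (12 * a - 2) * delta + (9 * a + 6)) / 36
    by rewrite /c3; field.
  by rewrite delta_root mul0r subr0.
have H := eq_uptov_affine delta (- (1 / (2 * a)))
  (((- 6 * a * delta + 8 * a + 3) / (6 * a)) *: u) f2_expansion f3_expansion.
move=> i; apply: eq_upto_trans (eq_upto_trans (H i) _); apply: near_eq_upto; near=> h.
  by rewrite /update_vec f1E scaleNr.
clear H; clearbody u1 u11 ud.
rewrite !quadE !mxE; move: (u 0 i) (u1 0 i) (u11 0 i) (ud 0 i) => ui A B D.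
move: E1 E2 E3; set b1 := _ / (6 * a); move: c3 b1 => e3 b1 E1 E2 E3.
transitivity ((b1 + delta - 1 / (2 * a)) * ui + h * ((- delta / 3 - e3 / (2 * a)) * A)
  + h ^+ 2 * ((delta / 18 - e3 ^+ 2 / (4 * a)) * B + 1 / 6 * D)); first by field.
by rewrite E1 E2 E3; field.
Unshelve. all: by end_near. Qed.
Let first_step (h : R) := Lam (Exp (h *: update_vec h)) p.

Lemma y_nextE (h : R) :
  y_next a delta h p = Lam (Exp (h *: ((- (1 / 3)) *: u))) (first_step h).
Proof.
by rewrite /y_next (action_mul (problem_action P)) -third_stepE.
Qed.

Let bnd_update : bndv update_vec.
Proof. exact: bndv_le update_expansion (bndv_quad _ _ _). Qed.

Let first_step_tends : tends_to_coord c first_step (c p).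
Proof.
by move=> r r0; exact: (tends_to_coord_exp Ac cp_image bnd_update (tends_to_coord_cst dp) r0).
Qed.

Let bnd_third v : bndv (fun=> v).
Proof. by move=> i; exact: bnd_cst. Qed.

Lemma y_next_tends : tends_to_coord c (fun h => y_next a delta h p) (c p).
Proof.
rewrite (_ : (fun h => _) = fun h => Lam (Exp (h *: ((- (1 / 3)) *: u))) (first_step h)).
  by move=> r r0; exact: (tends_to_coord_exp Ac cp_image (bnd_third _) first_step_tends r0).
by apply/funext => h; exact: y_nextE.
Qed.

(** For the commutator, the update factor gives [[:: u; u1]] and [[:: u1; u]] the weight
    [(4 / 3) (1 / 2) / 2 = 1 / 3] each; the reused exponential, acting afterwards, adds
    [- (1 / 3) (1 / 2) = - (1 / 6)] to [[:: u; u1]] alone. The result, [1 / 6] against [1 / 3], is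
    that of the flow. *)
Lemma y_next_expansion psi : smooth psi ->
  eq_upto 4 (fun h => psi (c (y_next a delta h p))) (third_order_jet psi).
Proof.
move=> spsi; set v := (- (1 / 3)) *: u.
have E : eq_upto 4 (fun h => psi (c (y_next a delta h p)))
    (fun h => \sum_(k < 4) h ^+ k *
      (lie_word (action_field c) (nseq k v) psi (c (first_step h)) / k`!%:R)).
  have := eq_upto_exp_stage Ac [::] 4 spsi cp_image (bnd_third v) first_step_tends.
  by apply: eq_upto_trans; apply: near_eq_upto; near=> h; rewrite y_nextE.
apply: eq_upto_trans E _.
(* The outer block of [k] letters carries [h ^+ k], so its inner expansion is cut at order
   [4 - k]. *)
have J l := @exp_expansion 3 l psi update_vec _ _ _ isT spsi update_expansion.
have J0 := J [::].
have J1 := eq_upto_shift 1 (eq_upto_trans (eq_upto_le (isT : 3 <= 4)%N (J [:: v]))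
  (eq_upto_trunc3 _ _ _ _)).
have J2 := eq_upto_shift 2 (eq_upto_trans (eq_upto_le (isT : 2 <= 4)%N (J [:: v; v]))
  (eq_upto_trunc2 _ _ _ _)).
have J3 := eq_upto_shift 3 (eq_upto_trans (eq_upto_le (isT : 1 <= 4)%N (J [:: v; v; v]))
  (eq_upto_trunc1 _ _ _ _)).
have T := eq_uptoD (eq_uptoD (eq_uptoD J0 J1) (eq_uptoZ (1 / 2) J2)) (eq_uptoZ (1 / 6) J3).
apply: eq_upto_trans (eq_upto_trans _ T) _; apply: near_eq_upto; near=> h.
  rewrite !big_ord_recl big_ord0.
  have -> : (2`! = 2)%N by [].
  have -> : (3`! = 6)%N by [].
  rewrite fact0 (_ : 1`! = 1%N) //.
  rewrite /= /bump /= !add1n expr0 divr1 mul1r addr0 !addrA !divr1.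
  by congr (_ + _ + _ + _); rewrite div1r mulrA mulrC.
rewrite /exp_jet /third_order_jet /v !cat_cons !cat0s.
rewrite !lie_word3Z !lie_word2Z !lie_word1Z lie_word1D.
rewrite (_ : word [::] psi = psi (c p)) //.
by abstract_words; field.
Unshelve. all: by end_near. Qed.
Lemma f_y_next_expansion :
  eq_uptov 2 (fun h => f (y_next a delta h p)) (quad u u1 0).
Proof.
move=> i; apply: (eq_upto_trans (g := fun h => f_coord i (c (y_next a delta h p)))).
  apply: near_eq_upto; apply: filterS (y_next_tends ltr01) => h [dh _].
  by rewrite /f_coord (chart_coordK (chart_isP Ac) dh).
apply: eq_upto_trans (eq_upto_le (isT : 2 <= 4)%N (y_next_expansion (smooth_f_coord i))) _.
apply: eq_upto_trans (eq_upto_trunc2 _ _ _ _) _; apply: near_eq_upto; near=> h.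
by rewrite quadE f_coord_p [u1 0 i]mxE mxE mulr0 addr0.
Unshelve. all: by end_near. Qed.

(** The trapezoidal rule: weight [1 / 2] on f_1 and on f(y_{n+1}). As the latter is [u + h u1] up to
    [h ^ 2], one exponential with exponent [h (u + (h / 2) u1)] reproduces the flow through
    [h ^ 2]. *)
Definition hat_row : 'rV[R]_4 := \row_(r < 4) (if (0 < r < 3)%N then 0 else 1 / 2).

Lemma y_hatE (h : R) : y_hat a delta [:: hat_row] h p =
  Lam (Exp (h *: ((1 / 2) *: u + (1 / 2) *: f (y_next a delta h p)))) p.
Proof.
rewrite /y_hat big_cons big_nil mulg1; congr (Lam (Exp (_ *: _)) _).
rewrite !big_ord_recl big_ord0 !mxE /= /bump /= !scale0r !add0r addr0 f1E.
by [].
Qed.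

Let bnd_hat : eq_uptov 2 (fun h => (1 / 2) *: u + (1 / 2) *: f (y_next a delta h p))
  (quad u ((1 / 2) *: u1) 0).
Proof.
have H := eq_uptov_affine (1 / 2) 0 ((1 / 2) *: u) f_y_next_expansion
  (fun=> eq_upto_refl 2 _) (z := fun=> 0).
move=> i; apply: eq_upto_trans (eq_upto_trans (H i) _); apply: near_eq_upto; near=> h.
  by rewrite scaler0 addr0.
clear H; clearbody u1 u11 ud.
by rewrite !(mxE, quadE); field.
Unshelve. all: by end_near. Qed.

Lemma y_hat_tends : tends_to_coord c (fun h => y_hat a delta [:: hat_row] h p) (c p).
Proof.
rewrite (_ : (fun h => _) = fun h => Lam (Exp (h *: ((1 / 2) *: u +
    (1 / 2) *: f (y_next a delta h p)))) p); last by apply/funext => h; exact: y_hatE.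
move=> r r0; have bw := bndv_le bnd_hat (bndv_quad _ _ _).
exact: (tends_to_coord_exp Ac cp_image bw (tends_to_coord_cst dp) r0).
Qed.

Lemma y_hat_expansion psi : smooth psi ->
  eq_upto 3 (fun h => psi (c (y_hat a delta [:: hat_row] h p))) (third_order_jet psi).
Proof.
move=> spsi.
have E := @exp_expansion 2 [::] psi _ _ _ _ isT spsi bnd_hat.
apply: eq_upto_trans (eq_upto_trans _ (eq_upto_trans E (eq_upto_trunc3 _ _ _ _)))
  (eq_upto_trans _ (eq_upto_sym (eq_upto_trunc3 _ _ _ _))).
  by apply: near_eq_upto; near=> h; rewrite y_hatE.
apply: near_eq_upto; near=> h; rewrite !cat0s lie_word1Z (_ : word [::] psi = psi (c p)) //.
by abstract_words; field.
Unshelve. all: by end_near. Qed.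
End Method.

End Expansions.

(** Flow and method are compared with one common jet. Both points lie in the chart for small [h], so
    a test function on [M] may be replaced by its representative through [param c]. *)
Lemma has_order_of_jet (R : realType) (q : nat) (step : method R) : (q <= 3)%N ->
  (forall (P : lie_problem R) (c : chart (M P) 'rV[R]_(dimM P)) (p : M P),
    atlasM c -> dom c p ->
    tends_to_coord c (fun h => step P h p) (c p) /\
    forall psi, smooth_on (c @` dom c) (psi : _ -> R^o) ->
      eq_upto q.+1 (fun h => psi (c (step P h p))) (third_order_jet c p psi)) ->
  has_order q step.
Proof.
move=> q3 H P phi Hphi p psi spsi.
have [c Ac dp] := manifold_cover (problem_manifold P) p.
have [ts /(_ _ (smooth_coord_rep Ac spsi)) es] := H P c p Ac dp.
have ef := eq_upto_le (q3 : (q.+1 <= 4)%N)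
  (flow_expansion Ac dp Hphi (smooth_coord_rep Ac spsi)).
have [C HC] := eq_upto_trans ef (eq_upto_sym es).
apply/eqO_exP; exists (`|C| + 1); first by rewrite ltr_wpDl.
apply: filterS3 HC (ts 1 ltr01) (near_flow Ac dp Hphi) => h hC [ds _] [df _].
move: hC; rewrite /= !(chart_coordK (chart_isP Ac))// => hC.
rewrite normrX (le_trans hC)// ler_wpM2r ?exprn_ge0// (le_trans (ler_norm _))//.
by rewrite lerDl.
Qed.

(** * The quadratic equation for [delta] *)

Lemma root_delta_poly (K : fieldType) (a delta : K) :
  root (delta_poly a) delta = (4 * a * delta ^+ 2 + (12 * a - 2) * delta + (9 * a + 6) == 0).
Proof. by rewrite rootE /delta_poly !(hornerD, hornerC, hornerZ, hornerX, hornerXn). Qed.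

Lemma discriminant_delta_poly (K : fieldType) (a : K) :
  quadratic_discriminant (delta_poly a) = 4 * (1 - 36 * a).
Proof.
rewrite /quadratic_discriminant /delta_poly !(coefD, coefZ, coefXn, coefX, coefC) /=.
by ring.
Qed.

Lemma rational_root_iff (a : rat) :
  (exists delta : rat, root (delta_poly a) delta) <-> (exists s : rat, 1 - 36 * a = s ^+ 2).
Proof.
split=> [[delta]|[s sE]].
  (* Completing the square: the witness is half the derivative of the polynomial at [delta]. *)
  rewrite root_delta_poly => /eqP E; exists (4 * a * delta + 6 * a - 1).
  have -> : (4 * a * delta + 6 * a - 1) ^+ 2 =
    4 * a * (4 * a * delta ^+ 2 + (12 * a - 2) * delta + (9 * a + 6)) + (1 - 36 * a) by ring.
  by rewrite E mulr0 add0r.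
(* For [a = 0] the polynomial degenerates to [- 2 z + 6], and the quadratic formula below would
   divide by 0. *)
have [->|a0] := eqVneq a 0; first by exists 3; rewrite root_delta_poly; apply/eqP; ring.
exists ((s + 1 - 6 * a) / (4 * a)); rewrite root_delta_poly; apply/eqP.
have -> : 4 * a * ((s + 1 - 6 * a) / (4 * a)) ^+ 2 +
  (12 * a - 2) * ((s + 1 - 6 * a) / (4 * a)) + (9 * a + 6) = (s ^+ 2 - (1 - 36 * a)) / (4 * a).
  by field.
by rewrite sE subrr mul0r.
Qed.

Theorem mainTheorem5 (R : realType) :
  (forall a delta : R, a != 0 -> root (delta_poly a) delta ->
    [/\ has_order 3 (y_next a delta),
        (forall (P : lie_problem R) (h : R) (p : M P),
          y_next a delta h p = Lam (g2 h p * update_exp a delta h p)%g p)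
      & exists beta : seq 'rV[R]_4,
          [/\ \sum_(b <- beta) b 0 (inord 3) != 0,
              has_order 2 (y_hat a delta beta)
            & forall (P : lie_problem R) (h : R) (p : M P),
                (f_values a delta h p)`_3 = f1 (y_next a delta h p)]]) /\
  (forall a : R,
    quadratic_discriminant (delta_poly a) = 4 * (1 - 36 * a)) /\
  (forall a : rat,
    (exists delta : rat, root (delta_poly a) delta) <->
    (exists s : rat, 1 - 36 * a = s ^+ 2)) /\
  root (delta_poly (0 : rat)) 3.
Proof.
split; last split; last split.
- move=> a delta a0; rewrite root_delta_poly => /eqP E; split=> //.
    apply: has_order_of_jet => // P c p Ac dp; split; first exact: y_next_tends.
    by move=> psi spsi; exact: y_next_expansion.
  exists [:: @hat_row R]; split.
  + rewrite big_seq1 mxE inordK//= mul1r invr_eq0 pnatr_eq0//.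
  + apply: has_order_of_jet => // P c p Ac dp; split; first exact: y_hat_tends.
    by move=> psi spsi; exact: y_hat_expansion.
  + by move=> P h p; rewrite /f1 (action_one (problem_action P)).
- exact: discriminant_delta_poly.
- exact: rational_root_iff.
- by rewrite root_delta_poly; apply/eqP; ring.
Qed.
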